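(* Let $X$ be a concrete ergodic fibrant cubeset. Then there exists a tower of surjective fibrations $$X\to\cdots\to\tau_2X\to\tau_1X\to\tau_0X$$ such that each $\tau_nX$ ($n\ge0$) is a concrete fibrant $n$-step cubeset and, for $n\ge1$ (and $x_0\in X(0)$), $\tau_nX$ is a principal $\mathcal D_n(\pi_n(X,x_0))$-bundle over $\tau_{n-1}X$. This tower is natural in $X$.
   Context: The cube category $\Box$ has objects $\{0,1\}^n$ ($n\in\mathbb N_0$); morphisms are the maps $\{0,1\}^n\to\{0,1\}^m$ that are restrictions of affine linear maps $\mathbb Z^n\to\mathbb Z^m$. A cubeset is a presheaf of sets $X$ on $\Box$; write $X(n)$ for its value on $\{0,1\}^n$ (the $n$-cubes) and $\Box^n$ for the presheaf represented by $\{0,1\}^n$. For $n\ge1$ and $1\le i\le n$, $\varepsilon_i\colon\{0,1\}^{n-1}\to\{0,1\}^n$ inserts a $0$ at coordinate $i$; the corner $\Lambda^n\subseteq\Box^n$ is the union of the images of the $\varepsilon_i\colon\Box^{n-1}\to\Box^n$. A cubeset $X$ is concrete if for all $n$ the vertex map $X(n)\to X(0)^{\{0,1\}^n}$ is injective; a map is a fibration if it has the right lifting property against all inclusions $\Lambda^n\to\Box^n$, $n\ge1$; $X$ is fibrant if $X\to *$ is a fibration; $X$ is $n$-step ($n\ge0$) if $\mathrm{Hom}(\Box^k,X)\to\mathrm{Hom}(\Lambda^k,X)$ is bijective for all $k>n$. The truncation $\tau_n$ is the left adjoint of the inclusion of $n$-step cubesets into cubesets; the tower consists of the maps $X\to\tau_nX$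 and $\tau_nX\to\tau_{n-1}X$ given by the units of these adjunctions. $X$ is ergodic if $\tau_0X=*$. Surjective means surjective on $n$-cubes for all $n$. Structure monoids. For an $n$-step cubeset $Y$, $n\ge1$, $y_0\in Y(0)$, $\pi_n(Y,y_0)$ is the set of $c\in Y(n)$ whose restriction to $\Lambda^n$ is constant $y_0$. Given $a,b\in\pi_n(Y,y_0)$ there is a unique $d\in Y(n+1)$ with $d\circ\varepsilon_1=a$, $d\circ\varepsilon_2=b$ and $d\circ\varepsilon_i$ constant $y_0$ for $3\le i\le n+1$; put $a*b=d\circ s$ with $s(x_1,\dots,x_n)=(x_1,x_1,x_2,\dots,x_n)$. For a general cubeset $X$ with $x_0\in X(0)$, $\pi_n(X,x_0):=\pi_n(\tau_nX,x_0)$ (image base point). For $X$ concrete fibrant it is an abelian group. Eilenberg–Mac Lane cubesets. For an abelian group $A$ and $k\ge1$, $\mathcal D_k(A)$ is the cubeset whose $n$-cubes are the subgroup of $A^{\{0,1\}^n}$ generated by the functions $a^F$ equal to $a$ on $F$ and $0$ off $F$, where $a\in A$ and $F$ runs over the faces of $\{0,1\}^n$ (subsets obtained by fixing some coordinates) of dimension at least $n-k$; restriction maps are precomposition. It is an abelian group object in cubesets. Principal bundle (no local triviality required). For a group object $G$ in a category, a principal $G$-bundle over $B$ is a map $p\colon P\to B$ with a $G$-action $\alpha\colon G\times P\to P$ over $B$ such that $(\alpha,\mathrm{pr}_2)\colon G\times P\to P\times_BP$ is an isomorphism and $G\times P\rightrightarrows P\xrightarrow{p}B$ (the two maps being $\alpha$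 and $\mathrm{pr}_2$) is a coequalizer. *)

(* Defs.v *)
From HB Require Import structures.
From mathcomp Require Import all_boot all_algebra.
From mathcomp Require Import boolp zify.

Set Implicit Arguments.
Unset Strict Implicit.
Unset Printing Implicit Defensive.
Set SsrOldRewriteGoalsOrder.

Import GRing.Theory.

Local Open Scope ring_scope.

Definition cube (n : nat) : Type := {ffun 'I_n -> bool}.
HB.instance Definition _ n := Finite.on (cube n).

Definition cvec n (x : cube n) : 'cV[int]_n := \col_i (x i : nat)%:Z.

Definition affine m n (f : cube m -> cube n) : Prop :=
  exists (A : 'M[int]_(n, m)) (b : 'cV[int]_n),
    forall x, cvec (f x) = A *m cvec x + b.

Record boxhom (m n : nat) := BoxHom {
  bfun :> cube m -> cube n;
  bfun_affine : affine bfun }.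

Lemma boxhom_eq m n (u v : boxhom m n) : u =1 v -> u = v.
Proof.
case: u v => [u hu] [v hv] /= /funext e.
by case: v / e hv => hv; congr BoxHom; apply: Prop_irrelevance.
Qed.

Lemma affine_id n : affine (@id (cube n)).
Proof. by exists 1%:M, 0 => x; rewrite mul1mx addr0. Qed.

Lemma affine_comp m n p (f : cube n -> cube p) (g : cube m -> cube n) :
  affine f -> affine g -> affine (f \o g).
Proof.
move=> [A [b hf]] [B [c hg]]; exists (A *m B), (A *m c + b) => x /=.
by rewrite hf hg mulmxDr mulmxA addrA.
Qed.

Definition bid n : boxhom n n := BoxHom (@affine_id n).

Definition bcomp m n p (u : boxhom n p) (v : boxhom m n) : boxhom m p :=
  BoxHom (affine_comp (bfun_affine u) (bfun_affine v)).

(* Maps each of whose coordinates is a coordinate of the source or constant. *)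
Definition coordfun m n (g : 'I_n -> option 'I_m) (c : 'I_n -> bool)
    (x : cube m) : cube n :=
  [ffun j => if g j is Some i then x i else c j].

Lemma coordfun_affine m n (g : 'I_n -> option 'I_m) (c : 'I_n -> bool) :
  affine (coordfun g c).
Proof.
exists (\matrix_(j, i) ((g j == Some i) : nat)%:Z),
  (\col_j if g j is Some _ then 0 else (c j : nat)%:Z) => x.
apply/colP => j; rewrite !mxE !ffunE.
case e: (g j) => [i|].
  rewrite addr0 (bigD1 i) //= !mxE e eqxx mul1r big1 ?addr0 // => k ki.
  rewrite !mxE e (_ : (Some i == Some k) = false) ?mul0r //.
  by apply/eqP => -[ik]; rewrite ik eqxx in ki.
by rewrite big1 ?add0r // => k _; rewrite !mxE e mul0r.
Qed.

Definition coordmap m n g c : boxhom m n := BoxHom (coordfun_affine g c).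

(* [eps i] inserts a [false] at the coordinate [i]. *)
Definition eps n (i : 'I_n) : boxhom n.-1 n :=
  coordmap (unlift i) (fun=> false).

Definition vertex n (v : cube n) : boxhom 0 n := coordmap (fun=> None) v.

Definition bterm n : boxhom n 0 := coordmap (fun=> None) (fun=> false).

(* (x_1, ..., x_n) |-> (x_1, x_1, x_2, ..., x_n) *)
Definition sdup n : boxhom n.+1 n.+2 :=
  coordmap (fun j => Some (odflt ord0 (unlift ord0 j))) (fun=> false).

Record cubeset := Cubeset {
  cell :> nat -> Type;
  act : forall m n, boxhom m n -> cell n -> cell m;
  act_id : forall n (x : cell n), act (bid n) x = x;
  act_comp : forall m n p (u : boxhom n p) (v : boxhom m n) (x : cell p),
    act (bcomp u v) x = act v (act u x) }.

Arguments act {c m n} u x.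

Record cmap (X Y : cubeset) := CMap {
  mfun :> forall n, X n -> Y n;
  mnat : forall m n (u : boxhom m n) (x : X n),
    mfun (act u x) = act u (mfun x) }.

Arguments mfun {X Y} c n x.

Lemma cmap_eq (X Y : cubeset) (f g : cmap X Y) :
  (forall n x, f n x = g n x) -> f = g.
Proof.
case: f g => [f hf] [g hg] /= e.
have {e} e : f = g by apply: functional_extensionality_dep => n; apply/funext.
by case: g / e hg => hg; congr CMap; apply: Prop_irrelevance.
Qed.

Lemma cmap_congr (X Y : cubeset) (f g : cmap X Y) n (x : X n) :
  f = g -> f n x = g n x.
Proof. by move->. Qed.

Definition cid_map (X : cubeset) : cmap X X :=
  @CMap X X (fun _ x => x) (fun _ _ _ _ => erefl).

Lemma ccomp_nat (X Y Z : cubeset) (g : cmap Y Z) (f : cmap X Y) m n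
  (u : boxhom m n) (x : X n) : g m (f m (act u x)) = act u (g n (f n x)).
Proof. by rewrite !mnat. Qed.

Definition ccomp (X Y Z : cubeset) (g : cmap Y Z) (f : cmap X Y) : cmap X Z :=
  @CMap X Z (fun n x => g n (f n x)) (ccomp_nat g f).

Notation "g \oc f" := (ccomp g f) (at level 50, left associativity).

Definition iso (X Y : cubeset) (f : cmap X Y) : Prop :=
  exists g : cmap Y X, g \oc f = cid_map X /\ f \oc g = cid_map Y.

Definition csurj (X Y : cubeset) (f : cmap X Y) : Prop :=
  forall n (y : Y n), exists x : X n, f n x = y.

Definition cpoint : cubeset :=
  @Cubeset (fun=> unit) (fun _ _ _ x => x) (fun _ _ => erefl)
    (fun _ _ _ _ _ _ => erefl).

Definition to_point (X : cubeset) : cmap X cpoint :=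
  @CMap X cpoint (fun _ _ => tt) (fun _ _ _ _ => erefl).

Definition Box (n : nat) : cubeset.
Proof.
refine (@Cubeset (fun m => boxhom m n) (fun _ _ u x => bcomp x u) _ _).
- by move=> m x; apply: boxhom_eq.
- by move=> m p q u v x; apply: boxhom_eq.
Defined.

Definition in_corner n m (u : boxhom m n) : Prop :=
  exists (i : 'I_n) (v : boxhom m n.-1), u = bcomp (eps i) v.

Lemma in_corner_act n m p (v : boxhom m p) (u : boxhom p n) :
  in_corner u -> in_corner (bcomp u v).
Proof. by move=> [i [w ->]]; exists i, (bcomp w v); apply: boxhom_eq. Qed.

(* For n = 0 this is the empty cubeset; corners are only filled for n >= 1. *)
Definition Corner (n : nat) : cubeset.
Proof.
refine (@Cubeset (fun m => {u : boxhom m n | in_corner u})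
  (fun _ _ v u => exist _ _ (in_corner_act v (svalP u))) _ _).
- by move=> m [u hu]; apply: eq_exist; apply: boxhom_eq.
- by move=> m p q v w [u hu]; apply: eq_exist; apply: boxhom_eq.
Defined.

Definition corner_incl (n : nat) : cmap (Corner n) (Box n) :=
  @CMap (Corner n) (Box n) (fun _ u => sval u) (fun _ _ _ _ => erefl).

Definition concrete (X : cubeset) : Prop :=
  forall n, injective (fun (x : X n) (v : cube n) => act (vertex v) x).

Definition fibration (X Y : cubeset) (f : cmap X Y) : Prop :=
  forall n, (0 < n)%N ->
  forall (c : cmap (Corner n) X) (b : cmap (Box n) Y),
    f \oc c = b \oc corner_incl n ->
  exists l : cmap (Box n) X, l \oc corner_incl n = c /\ f \oc l = b.

Definition fibrant (X : cubeset) : Prop := fibration (to_point X).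

Definition nstep (n : nat) (X : cubeset) : Prop :=
  forall k, (n < k)%N ->
  bijective (fun l : cmap (Box k) X => l \oc corner_incl k).

Lemma nstepS n X : nstep n X -> nstep n.+1 X.
Proof. by move=> h k nk; apply: h; apply: ltnW. Qed.

Definition yo (X : cubeset) n (x : X n) : cmap (Box n) X.
Proof.
refine (@CMap (Box n) X (fun _ u => act u x) _).
by move=> m p u v; rewrite /= act_comp.
Defined.

Lemma yoK (X : cubeset) n (l : cmap (Box n) X) : yo (l n (bid n)) = l.
Proof.
apply: cmap_eq => m u /=; rewrite -mnat; congr (l m _).
by apply: boxhom_eq.
Qed.

Lemma nstep_fill n (X : cubeset) k (c : cmap (Corner k) X) :
  nstep n X -> (n < k)%N ->
  exists x : X k, forall m (u : Corner k m), act (sval u) x = c m u.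
Proof.
move=> h /h [r _ rK]; exists (r c k (bid k)) => m u.
rewrite -(cmap_congr u (rK c)) /=.
by rewrite -mnat; congr (r c m _); apply: boxhom_eq.
Qed.

Lemma nstep_inj n (X : cubeset) k (x y : X k) :
  nstep n X -> (n < k)%N ->
  (forall m (u : Corner k m), act (sval u) x = act (sval u) y) -> x = y.
Proof.
move=> h /h /bij_inj i e.
have : yo x = yo y by apply: i; apply: cmap_eq => m u; apply: e.
move=> /(@cmap_congr (Box k) X _ _ k (bid k)) /=.
by rewrite !act_id.
Qed.

Lemma nstep_intro n (X : cubeset) :
  (forall k (c : cmap (Corner k) X), (n < k)%N ->
     exists x : X k, forall m (u : Corner k m), act (sval u) x = c m u) ->
  (forall k (x y : X k), (n < k)%N ->
     (forall m (u : Corner k m), act (sval u) x = act (sval u) y) -> x = y) ->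
  nstep n X.
Proof.
move=> hex hin k nk.
exists (fun c => yo (sval (cid (hex k c nk)))).
  move=> l; rewrite -[RHS]yoK; congr yo; apply: hin => // m u.
  case: cid => x /= ->; rewrite -mnat; congr (l m _); exact: boxhom_eq.
by move=> c; case: cid => x /= hx; apply: cmap_eq => m u /=; rewrite hx.
Qed.

Lemma eps_inj n (i : 'I_n.+1) m (v w : boxhom m n) :
  bcomp (eps i) v = bcomp (eps i) w -> v = w.
Proof.
move=> e; apply: boxhom_eq => x; apply/ffunP => j.
move: e => /(congr1 (fun f : boxhom _ _ => f x (lift i j))) /=.
by rewrite !ffunE liftK.
Qed.

Lemma corner_glue n (X : cubeset) (c : 'I_n.+1 -> X n) :
  (forall (i j : 'I_n.+1) m (v w : boxhom m n), bcomp (eps i) v = bcomp (eps j) w ->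
     act v (c i) = act w (c j)) ->
  exists g : cmap (Corner n.+1) X,
    forall (i : 'I_n.+1) m (v : boxhom m n) h, g m (exist _ (bcomp (eps i) v) h) = act v (c i).
Proof.
move=> hc.
pose P m (u : Corner n.+1 m) (y : X m) :=
  forall (i : 'I_n.+1) (v : boxhom m n), sval u = bcomp (eps i) v -> y = act v (c i).
have hP m u : exists y, @P m u y.
  case: u => u [i [v e]]; exists (act v (c i)) => j w /= e'.
  by apply: hc; rewrite -e -e'.
pose g m u := sval (cid (@hP m u)).
have gP m u : P m u (g m u) by rewrite /g; case: cid.
have gnat m p (u : boxhom m p) (x : Corner n.+1 p) :
    g m (act u x) = act u (g p x).
  case: (svalP x) => i [v e]; rewrite (gP _ _ _ _ e) -act_comp.
  by apply: gP; rewrite /= e; apply: boxhom_eq.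
by exists (CMap gnat) => i m v h /=; apply: gP.
Qed.

Definition is_truncation n (X T : cubeset) (eta : cmap X T) : Prop :=
  nstep n T /\
  forall Y : cubeset, nstep n Y -> forall f : cmap X Y,
    exists! g : cmap T Y, g \oc eta = f.

(* Existence of the left adjoint: the cells of the free n-step cubeset on X are
   formal restrictions and corner fillings of cells of X, up to the partial
   equivalence relation [eqv]; a term [t] denotes a cell when [eqv t t]. *)
Section Free.
Variables (n : nat) (X : cubeset).

Inductive term : nat -> Type :=
| Tin m : X m -> term m
| Tact m p : boxhom m p -> term p -> term m
| Tfill k : (forall m, Corner k m -> term m) -> term k.

Inductive eqv : forall m, term m -> term m -> Prop :=
| eqv_sym m (s t : term m) : eqv s t -> eqv t s
| eqv_trans m (s t r : term m) : eqv s t -> eqv t r -> eqv s r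
| eqv_in m (x : X m) : eqv (Tin x) (Tin x)
| eqv_act m p (u : boxhom m p) s t : eqv s t -> eqv (Tact u s) (Tact u t)
| eqv_nat m p (u : boxhom m p) (x : X p) :
    eqv (Tact u (Tin x)) (Tin (act u x))
| eqv_id m (t : term m) : eqv t t -> eqv (Tact (bid m) t) t
| eqv_comp m p q (u : boxhom p q) (v : boxhom m p) t : eqv t t ->
    eqv (Tact (bcomp u v) t) (Tact v (Tact u t))
| eqv_fill k (h h' : forall m, Corner k m -> term m) : (n < k)%N ->
    (forall m p (u : boxhom m p) c, eqv (h m (act u c)) (Tact u (h p c))) ->
    (forall m c, eqv (h m c) (h' m c)) ->
    eqv (Tfill h) (Tfill h')
| eqv_beta k (h : forall m, Corner k m -> term m) m (c : Corner k m) :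
    (n < k)%N ->
    (forall m p (u : boxhom m p) c, eqv (h m (act u c)) (Tact u (h p c))) ->
    (forall m c, eqv (h m c) (h m c)) ->
    eqv (Tact (sval c) (Tfill h)) (h m c)
| eqv_eta k (t : term k) : (n < k)%N -> eqv t t ->
    eqv (Tfill (fun m (c : Corner k m) => Tact (sval c) t)) t.

Lemma eqv_l m (s t : term m) : eqv s t -> eqv s s.
Proof. by move=> h; apply: (eqv_trans h); apply: eqv_sym. Qed.

Definition fcell m := {P : term m -> Prop | exists t, eqv t t /\ P = eqv t}.

Definition cls m (t : term m) (h : eqv t t) : fcell m :=
  exist _ (eqv t) (ex_intro _ t (conj h erefl)).

Definition rep m (P : fcell m) : term m := sval (cid (svalP P)).

Lemma rep_eqv m (P : fcell m) : eqv (rep P) (rep P).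
Proof. by rewrite /rep; case: cid => t []. Qed.

Lemma cls_eq m (s t : term m) hs ht : eqv s t -> @cls m s hs = @cls m t ht.
Proof.
move=> e; apply: eq_exist; apply/funext => r; apply/propext; split => h.
  by apply: eqv_trans h; apply: eqv_sym.
exact: eqv_trans h.
Qed.

Lemma clsK m (P : fcell m) : cls (rep_eqv P) = P.
Proof.
case: P => P hP; apply: eq_exist => /=; rewrite /rep /=.
by case: cid => t [].
Qed.

Lemma rep_cls m (t : term m) h : eqv (rep (@cls m t h)) t.
Proof.
rewrite /rep; case: cid => s [hs /= e].
by rewrite -e.
Qed.

Lemma fcell_ind (Q : forall m, fcell m -> Prop) :
  (forall m (t : term m) (h : eqv t t), Q m (cls h)) -> forall m P, Q m P.
Proof. by move=> hQ m P; rewrite -(clsK P). Qed.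

Definition fact m p (u : boxhom m p) (P : fcell p) : fcell m :=
  cls (eqv_act u (rep_eqv P)).

Lemma fact_cls m p (u : boxhom m p) (t : term p) h h' :
  fact u (@cls p t h) = @cls m (Tact u t) h'.
Proof. by apply: cls_eq; apply: eqv_act; apply: rep_cls. Qed.

Definition free : cubeset.
Proof.
refine (@Cubeset fcell fact _ _).
- move=> m P; rewrite -[RHS]clsK; apply: cls_eq.
  exact: eqv_id (rep_eqv P).
- move=> m p q u v P; apply: cls_eq.
  apply: eqv_trans (eqv_comp _ _ (rep_eqv P)) _.
  by apply: eqv_act; apply: eqv_sym; apply: rep_cls.
Defined.

Definition free_unit : cmap X free.
Proof.
refine (@CMap X free (fun m x => cls (eqv_in x)) _).
move=> m p u x; apply: cls_eq; apply: eqv_sym.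
apply: eqv_trans (eqv_nat u x); apply: eqv_act; exact: rep_cls.
Defined.

Lemma free_step : nstep n free.
Proof.
apply: nstep_intro.
  move=> k c nk.
  pose h m (x : Corner k m) := rep (c m x).
  have hn m p (u : boxhom m p) x : eqv (h m (act u x)) (Tact u (h p x)).
    rewrite /h mnat; exact: rep_cls.
  have hh m x : eqv (h m x) (h m x) by apply: rep_eqv.
  have hf : eqv (Tfill h) (Tfill h) by apply: eqv_fill.
  exists (cls hf) => m u; rewrite -[RHS]clsK; apply: cls_eq.
  apply: eqv_trans (eqv_beta u nk hn hh).
  by apply: eqv_act; apply: rep_cls.
move=> k x y nk e; rewrite -(clsK x) -(clsK y); apply: cls_eq.
apply: eqv_trans (eqv_sym (eqv_eta nk (rep_eqv x))) _.
apply: eqv_trans (eqv_eta nk (rep_eqv y)).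
apply: eqv_fill => // [m p u c|m c].
  apply: eqv_comp; exact: rep_eqv.
have E := e m c.
apply: eqv_trans (eqv_sym (rep_cls (eqv_act (sval c) (rep_eqv x)))) _.
by move: E; rewrite /= /fact => ->; apply: rep_cls.
Qed.

Section Univ.
Variables (Y : cubeset) (hY : nstep n Y) (f : cmap X Y).

Fixpoint ev m (t : term m) : Y m -> Prop :=
  match t in term m return Y m -> Prop with
  | Tin _ x => fun y => y = f _ x
  | Tact _ _ u t => fun y => exists2 z, ev t z & y = act u z
  | Tfill _ h => fun y => forall m c, ev (h m c) (act (sval c) y)
  end.

Lemma ev_fill k (h : forall m, Corner k m -> term m) : (n < k)%N ->
  (forall m p (u : boxhom m p) c, exists y,
     (forall z, ev (h m (act u c)) z <-> z = y) /\
     (forall z, ev (Tact u (h p c)) z <-> z = y)) ->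
  (forall m c, exists y, forall z, ev (h m c) z <-> z = y) ->
  exists y, (forall z, ev (Tfill h) z <-> z = y) /\
    (forall m c, ev (h m c) (act (sval c) y)).
Proof.
move=> nk hn hh.
pose g m c := sval (cid (hh m c)).
have gP m c z : ev (h m c) z <-> z = g m c by rewrite /g; case: cid => y /=.
have gn m p (u : boxhom m p) (c : Corner k p) : g m (act u c) = act u (g p c).
  have [y [h1 h2]] := hn m p u c.
  have -> : g m (act u c) = y by apply/h1/gP.
  by apply/esym/h2; exists (g p c) => //; apply/gP.
have [y hy] := nstep_fill (CMap gn) hY nk.
exists y; split; last by move=> m c; rewrite hy; apply/gP.
move=> z; split => [hz|->]; last by move=> m c; rewrite hy; apply/gP.
by apply: (nstep_inj hY nk) => m c; rewrite hy; apply/gP; apply: hz.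
Qed.

Lemma ev_eqv m (s t : term m) : eqv s t ->
  exists y, (forall z, ev s z <-> z = y) /\ (forall z, ev t z <-> z = y).
Proof.
elim=> {m s t}.
- by move=> m s t _ [y [h1 h2]]; exists y.
- move=> m s t r _ [y [h1 h2]] _ [z [h3 h4]]; exists y; split=> //.
  by have -> : y = z by apply/h3/h2.
- by move=> m x; exists (f m x).
- move=> m p u s t _ [y [h1 h2]]; exists (act u y).
  split=> z /=; split=> [[w]|->].
  + by move=> /h1 -> ->.
  + by exists y => //; apply/h1.
  + by move=> /h2 -> ->.
  + by exists y => //; apply/h2.
- move=> m p u x; exists (f m (act u x)); split=> z //=; rewrite mnat.
  by split=> [[w -> ->]|->] //; exists (f p x).
- move=> m t _ [y [h1 _]]; exists y; split=> // z /=; split=> [[w /h1 -> ->]|->].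
    by rewrite act_id.
  by exists y; [apply/h1|rewrite act_id].
- move=> m p q u v t _ [y [h1 _]]; exists (act (bcomp u v) y); split=> z /=.
    by split=> [[w /h1 -> ->]|->] //; exists y => //; apply/h1.
  rewrite act_comp; split=> [[w [w' /h1 -> ->] ->]|->] //.
  by exists (act u y) => //; exists y => //; apply/h1.
- move=> k h h' nk _ hn _ hh.
  have hh1 m c : exists y, forall z, ev (h m c) z <-> z = y.
    by have [y []] := hh m c; exists y.
  have [y [hy yh]] := ev_fill nk hn hh1; exists y; split=> // z.
  have E m c w : ev (h m c) w <-> ev (h' m c) w.
    by have [r [h1 h2]] := hh m c; rewrite h1 h2.
  by rewrite -hy /=; split=> H m c; apply/E.
- move=> k h m c nk _ hn _ hh.
  have hh1 m' c' : exists y, forall z, ev (h m' c') z <-> z = y.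
    by have [y []] := hh m' c'; exists y.
  have [y [hy yh]] := ev_fill nk hn hh1; exists (act (sval c) y); split=> z.
    split=> [[w /hy -> ->]|->] //; exists y => //; exact/hy.
  have [r [h1 _]] := hh m c; rewrite h1.
  by have -> : act (sval c) y = r by apply/h1.
- move=> k t nk _ [y [h1 _]]; exists y; split=> // z /=; split=> [H|->].
    apply: (nstep_inj hY nk) => m c.
    by have [w /h1 -> ->] := H m c.
  by move=> m c; exists y => //; apply/h1.
Qed.

Lemma ev_val m (P : free m) : exists y, forall z, ev (rep P) z <-> z = y.
Proof. by have [y [h _]] := ev_eqv (rep_eqv P); exists y. Qed.

Definition lift_fun m (P : free m) : Y m := sval (cid (ev_val P)).

Lemma lift_cls m (t : term m) h : ev t (lift_fun (@cls m t h)).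
Proof.
rewrite /lift_fun; case: cid => y /= hy.
have [z [h1 h2]] := ev_eqv (rep_cls h).
by apply/h2/h1/hy.
Qed.

Lemma ev_uniq m (t : term m) y z : eqv t t -> ev t y -> ev t z -> y = z.
Proof. by move=> /ev_eqv [w [h _]] /h -> /h ->. Qed.

Lemma lift_nat m p (u : boxhom m p) (P : free p) :
  lift_fun (act u P) = act u (lift_fun P).
Proof.
rewrite -(clsK P) /= (fact_cls _ (eqv_act u (rep_eqv P))).
apply: (ev_uniq (eqv_act u (rep_eqv P))); first exact: lift_cls.
by exists (lift_fun (cls (rep_eqv P))) => //; apply: lift_cls.
Qed.

Lemma ev_any (g : cmap free Y) : g \oc free_unit = f ->
  forall m (s t : term m), eqv s t ->
  (forall h, ev s (g m (@cls m s h))) /\ (forall h, ev t (g m (@cls m t h))).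
Proof.
move=> gf.
have ga m p (u : boxhom m p) t (h : eqv t t) h' :
    g m (@cls m (Tact u t) h') = act u (g p (@cls p t h)).
  by rewrite -mnat /= (fact_cls _ h').
have gfill k (h : forall m, Corner k m -> term m) hf : (n < k)%N ->
    (forall m p (u : boxhom m p) c, eqv (h m (act u c)) (Tact u (h p c))) ->
    (forall m c, eqv (h m c) (h m c)) ->
    (forall m c hc, ev (h m c) (g m (@cls m (h m c) hc))) ->
    ev (Tfill h) (g k (@cls k (Tfill h) hf)).
  move=> nk hn hh hev m c /=; rewrite -(ga _ _ _ _ _ (eqv_act (sval c) hf)).
  rewrite (cls_eq (eqv_act (sval c) hf) (hh m c) (eqv_beta c nk hn hh)); exact: hev.
move=> m s t; elim=> {m s t}.
- by move=> m s t _ [].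
- by move=> m s t r _ [h1 h2] _ [h3 h4].
- move=> m x; have H h : ev (Tin x) (g m (@cls m (Tin x) h)).
    rewrite /= -gf /=; congr (g m _); exact: cls_eq (eqv_in x).
  by split.
- move=> m p u s t e [h1 h2]; split=> h /=.
    by exists (g p (cls (eqv_l e))) => //; apply: ga.
  by exists (g p (cls (eqv_l (eqv_sym e)))) => //; apply: ga.
- move=> m p u x; split=> h /=.
    exists (g p (cls (eqv_in x))); last exact: ga.
    by rewrite -gf.
  rewrite -gf /=; congr (g m _); exact: cls_eq (eqv_in _).
- move=> m t ht [h1 _]; split=> // h /=.
  by exists (g m (cls ht)) => //; apply: ga.
- move=> m p q u v t ht [h1 _]; split=> h /=.
    by exists (g q (cls ht)) => //; apply: ga.
  exists (g p (cls (eqv_act u ht))); last exact: ga.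
  by exists (g q (cls ht)) => //; apply: ga.
- move=> k h h' nk en hn ee hh; split=> hf.
    by apply: gfill => // [m c|m c]; [exact: eqv_l (ee m c)|have [] := hh m c].
  apply: gfill => // [m p u c|m c|m c].
  + apply: eqv_trans (eqv_sym (ee _ _)) _; apply: eqv_trans (en _ _ _ _) _.
    exact: eqv_act.
  + exact: eqv_l (eqv_sym (ee m c)).
  + by have [] := hh m c.
- move=> k h m c nk en hn ee hh; split; last by have [] := hh m c.
  have hf : eqv (Tfill h) (Tfill h) by apply: eqv_fill.
  move=> h0; exists (g k (cls hf)); last exact: ga.
  by apply: gfill => // m' c'; have [] := hh m' c'.
- move=> k t nk ht [h1 _]; split=> // h /= m c.
  exists (g k (cls ht)) => //; congr (act _ (g k _)).
  by apply: cls_eq; apply: eqv_eta.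
Qed.

Lemma free_univ : exists! g : cmap free Y, g \oc free_unit = f.
Proof.
have hl : CMap lift_nat \oc free_unit = f.
  by apply: cmap_eq => m x /=; have := lift_cls (eqv_in x).
exists (CMap lift_nat); split=> // g gf; apply: cmap_eq.
apply: fcell_ind => m t h.
apply: (ev_uniq h); first by have [] := ev_any hl h.
by have [] := ev_any gf h.
Qed.

End Univ.
End Free.

Lemma truncation_exists n (X : cubeset) :
  exists T : {T : cubeset & cmap X T}, is_truncation n (projT2 T).
Proof.
exists (existT _ (free n X) (free_unit n X)); split; first exact: free_step.
by move=> Y hY f; apply: free_univ.
Qed.

Definition tau (n : nat) (X : cubeset) : cubeset :=
  projT1 (sval (cid (truncation_exists n X))).

Definition tau_unit (n : nat) (X : cubeset) : cmap X (tau n X) :=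
  projT2 (sval (cid (truncation_exists n X))).

Lemma tauP n X : is_truncation n (tau_unit n X).
Proof. by rewrite /tau_unit /tau; case: cid. Qed.

Lemma tau_step n X : nstep n (tau n X).
Proof. by have [] := tauP n X. Qed.

Arguments tau_step n X : clear implicits.

Lemma tau_ext_exists n (X Y : cubeset) (hY : nstep n Y) (f : cmap X Y) :
  exists g : cmap (tau n X) Y, g \oc tau_unit n X = f.
Proof. by have [_ /(_ Y hY f)[g []]] := tauP n X; exists g. Qed.

Definition tau_ext n (X Y : cubeset) (hY : nstep n Y) (f : cmap X Y) :
  cmap (tau n X) Y := sval (cid (tau_ext_exists hY f)).

Lemma tau_extE n (X Y : cubeset) (hY : nstep n Y) (f : cmap X Y) :
  tau_ext hY f \oc tau_unit n X = f.
Proof. by rewrite /tau_ext; case: cid. Qed.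

Lemma tau_ext_uniq n (X Y : cubeset) (g h : cmap (tau n X) Y) :
  nstep n Y -> g \oc tau_unit n X = h \oc tau_unit n X -> g = h.
Proof.
move=> hY e; have [_ /(_ Y hY (h \oc tau_unit n X))[k [_ kU]]] := tauP n X.
by rewrite -(kU h erefl) -(kU g e).
Qed.

Definition tau_map n (X Y : cubeset) (f : cmap X Y) : cmap (tau n X) (tau n Y) :=
  tau_ext (tau_step n Y) (tau_unit n Y \oc f).

Definition tau_proj n (X : cubeset) : cmap (tau n.+1 X) (tau n X) :=
  tau_ext (nstepS (tau_step n X)) (tau_unit n X).

Lemma tau_map_unit n (X Y : cubeset) (f : cmap X Y) :
  tau_map n f \oc tau_unit n X = tau_unit n Y \oc f.
Proof. exact: tau_extE. Qed.

Lemma tau_map_id n (X : cubeset) : tau_map n (cid_map X) = cid_map (tau n X).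
Proof.
apply: (tau_ext_uniq (tau_step n X)); rewrite tau_map_unit.
exact: cmap_eq.
Qed.

Lemma tau_map_comp n (X Y Z : cubeset) (g : cmap Y Z) (f : cmap X Y) :
  tau_map n (g \oc f) = tau_map n g \oc tau_map n f.
Proof.
apply: (tau_ext_uniq (tau_step n Z)); rewrite tau_map_unit.
apply: cmap_eq => m x /=.
have /= -> := cmap_congr x (tau_map_unit n f).
by have /= -> := cmap_congr (f m x) (tau_map_unit n g).
Qed.

Definition ergodic (X : cubeset) : Prop := iso (to_point (tau 0 X)).

Definition constc (X : cubeset) (x0 : X 0) n : X n := act (bterm n) x0.

Definition pi n (Y : cubeset) (y0 : Y 0) : Type :=
  {c : Y n | forall m (u : Corner n m), act (sval u) c = constc y0 m}.

Lemma act_constc (Y : cubeset) (y0 : Y 0) m n (u : boxhom m n) :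
  act u (constc y0 n) = constc y0 m.
Proof.
rewrite /constc -act_comp; congr act; apply: boxhom_eq => x.
by apply/ffunP => -[].
Qed.

Section PiMul.
Variables (n : nat) (Y : cubeset) (y0 : Y 0).

(* Coordinates are numbered from 0 here: eps_1, eps_2 are [eps 0], [eps 1]. *)
Definition mul_cube (a b : pi n.+1 y0) (d : Y n.+2) : Prop :=
  [/\ act (eps 0) d = sval a, act (eps 1) d = sval b &
      forall i : 'I_n.+2, (1 < i)%N -> act (eps i) d = constc y0 n.+1].

Lemma zero_factor m k (i : 'I_k.+1) (v : boxhom m k.+1) :
  (forall x, v x i = false) -> exists w : boxhom m k, v = bcomp (eps i) w.
Proof.
move=> hv.
exists (bcomp (coordmap (fun j => Some (lift i j)) (fun=> false)) v).
apply: boxhom_eq => x; apply/ffunP => j; rewrite !ffunE.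
by case: unliftP => [j' ->|->] //; rewrite ffunE.
Qed.

Lemma corner_zero m k (i : 'I_k) (v : boxhom m k) :
  (forall x, v x i = false) -> in_corner v.
Proof. by case: k i v => [[]//|k] i v /zero_factor [w]; exists i, w. Qed.

Lemma pi_corner k (y1 : Y 0) (c : pi k y1) (i : 'I_k) m (v : boxhom m k) :
  (forall x, v x i = false) -> act v (sval c) = constc y1 m.
Proof.
by move=> /corner_zero hv; apply: (svalP c m (exist _ v hv)).
Qed.

Lemma constc_pi k : forall m (u : Corner k m),
  act (sval u) (constc y0 k) = constc y0 m.
Proof. by move=> m u; apply: act_constc. Qed.

Definition pi_const k : pi k y0 := exist _ (constc y0 k) (@constc_pi k).

Lemma mul_cube_exists (hY : nstep n.+1 Y) a b : exists d, mul_cube a b d.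
Proof.
pose c (i : 'I_n.+2) : pi n.+1 y0 :=
  if val i == 0 then a else if val i == 1 then b else pi_const n.+1.
have hc (i j : 'I_n.+2) m (v w : boxhom m n.+1) : bcomp (eps i) v = bcomp (eps j) w ->
    act v (sval (c i)) = act w (sval (c j)).
  case: (eqVneq i j) => [-> /eps_inj -> //|ij e].
  have [j' ej _] := unlift_some ij.
  have ji : j != i by rewrite eq_sym.
  have [i' ei _] := unlift_some ji.
  rewrite (@pi_corner _ _ _ j'); last first.
    move=> x; move: e => /(congr1 (fun f : boxhom _ _ => f x j)) /=.
    by rewrite !ffunE ej liftK unlift_none.
  rewrite (@pi_corner _ _ _ i') // => x.
  move: e => /(congr1 (fun f : boxhom _ _ => f x i)) /=.
  by rewrite !ffunE ei liftK unlift_none.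
have [g hg] := corner_glue hc.
have [d hd] := nstep_fill g hY (ltnSn _).
have hdi i : act (eps i) d = sval (c i).
  have he : in_corner (bcomp (eps i) (bid n.+1)) by exists i, (bid _).
  rewrite -[RHS]act_id -(hg i _ (bid _) he) -hd; congr act.
  exact: boxhom_eq.
exists d; split; rewrite ?hdi //.
by move=> i i1; rewrite hdi /c; case: i i1 => [[|[|i]]].
Qed.

Lemma mul_cube_uniq (hY : nstep n.+1 Y) a b d e :
  mul_cube a b d -> mul_cube a b e -> d = e.
Proof.
move=> [d0 d1 di] [e0 e1 ei]; apply: (nstep_inj hY (ltnSn _)) => m [u [i [v uE]]].
rewrite /= {}uE !act_comp; congr act.
have [i1|] := ltnP 1 i; first by rewrite di // ei.
case: i => [[|[|i]]] //= hi _.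
  by rewrite (_ : Ordinal hi = 0) ?d0 ?e0 //; apply: val_inj.
by rewrite (_ : Ordinal hi = 1) ?d1 ?e1 //; apply: val_inj.
Qed.

Lemma mul_cube_pi a b d : mul_cube a b d ->
  forall m (u : Corner n.+1 m), act (sval u) (act (sdup n) d) = constc y0 m.
Proof.
move=> [d0 _ di] m [u [i [v uE]]]; rewrite /= {}uE -act_comp.
case: (unliftP ord0 i) => [i'|] ei.
  have /zero_factor [w ->] :
      forall x, bcomp (sdup n) (bcomp (eps i) v) x (lift ord0 i) = false.
    by move=> x; rewrite /= !ffunE liftK /= ?ffunE unlift_none.
  by rewrite act_comp di ?act_constc // ei.
have h0 x : bcomp (sdup n) (bcomp (eps i) v) x 0 = false.
  by rewrite /= !ffunE (_ : 0 = ord0) ?unlift_none /= ?ffunE ?ei ?unlift_none.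
have [w wE] := zero_factor h0; rewrite wE act_comp d0.
apply: (@pi_corner _ _ _ ord0) => x.
have := congr1 (fun f : boxhom _ _ => f x (lift 0 ord0)) wE.
rewrite /= [X in _ = X]ffunE liftK => <-.
by rewrite /= !ffunE (_ : 0 = ord0) // liftK /= ?ffunE ei unlift_none.
Qed.

Definition pi_mul (hY : nstep n.+1 Y) (a b : pi n.+1 y0) : pi n.+1 y0 :=
  let d := cid (mul_cube_exists hY a b) in
  exist _ (act (sdup n) (sval d)) (mul_cube_pi (svalP d)).

End PiMul.

Lemma pi_map_subproof k (Y Z : cubeset) (g : cmap Y Z) (y0 : Y 0) (z0 : Z 0)
  (e : g 0 y0 = z0) (c : pi k y0) m (u : Corner k m) :
  act (sval u) (g k (sval c)) = constc z0 m.
Proof. by rewrite -mnat (svalP c) /constc mnat e. Qed.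

Definition pi_map k (Y Z : cubeset) (g : cmap Y Z) (y0 : Y 0) (z0 : Z 0)
    (e : g 0 y0 = z0) (c : pi k y0) : pi k z0 :=
  exist _ (g k (sval c)) (pi_map_subproof e c).

Lemma pi_map_mul n (Y Z : cubeset) (g : cmap Y Z) (y0 : Y 0) (z0 : Z 0)
    (e : g 0 y0 = z0) (hY : nstep n.+1 Y) (hZ : nstep n.+1 Z) (a b : pi n.+1 y0) :
  pi_map e (pi_mul hY a b) = pi_mul hZ (pi_map e a) (pi_map e b).
Proof.
rewrite /pi_mul; case: cid => d hd; case: cid => d' hd'.
apply: eq_exist => /=; rewrite mnat; congr act.
apply: (mul_cube_uniq hZ) hd'; case: hd => h0 h1 hi.
split; rewrite /= -?mnat ?h0 ?h1 // => i i1.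
by rewrite -mnat hi // /constc mnat e.
Qed.

(* [tpi n X x0] is pi_n(X, x0) for an arbitrary cubeset X. *)
Definition tpi n (X : cubeset) (x0 : X 0) : Type := pi n (tau_unit n X 0 x0).

Definition tpi_mul n (X : cubeset) (x0 : X 0) :
  tpi n.+1 x0 -> tpi n.+1 x0 -> tpi n.+1 x0 := pi_mul (tau_step n.+1 X).

Lemma tau_map_unit0 n (X Y : cubeset) (f : cmap X Y) (x0 : X 0) :
  tau_map n f 0 (tau_unit n X 0 x0) = tau_unit n Y 0 (f 0 x0).
Proof. exact: cmap_congr x0 (tau_map_unit n f). Qed.

Arguments tpi_mul : clear implicits.

Definition tpi_map n (X Y : cubeset) (f : cmap X Y) (x0 : X 0) :
  tpi n x0 -> tpi n (f 0 x0) := pi_map (tau_map_unit0 n f x0).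

Arguments tpi_map : clear implicits.

Lemma tpi_map_mul n (X Y : cubeset) (f : cmap X Y) (x0 : X 0) :
  {morph tpi_map n.+1 X Y f x0 : a b /
    tpi_mul n X x0 a b >-> tpi_mul n Y (f 0 x0) a b}.
Proof. by move=> a b; apply: pi_map_mul. Qed.

Arguments tpi_map_mul : clear implicits.

Definition abelian_law (T : Type) (op : T -> T -> T) : Prop :=
  [/\ associative op, commutative op &
      exists e, left_id e op /\ forall x, exists y, op y x = e].

(* T as an abelian group (zmodType) with addition op *)
Definition law_group (T : Type) (op : T -> T -> T) (H : abelian_law op) : Type := T.

Section LawGroup.
Variables (T : Type) (op : T -> T -> T) (H : abelian_law op).

Let unitP : exists e, left_id e op /\ forall x, exists y, op y x = e.
Proof. by case: H. Qed.

Definition law_zero : law_group H := sval (cid unitP).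

Let oppP (x : T) : exists y, op y x = law_zero.
Proof. by rewrite /law_zero; case: cid => e [/= _]. Qed.

Definition law_opp (x : law_group H) : law_group H := sval (cid (oppP x)).

Let addA : associative (op : law_group H -> law_group H -> law_group H).
Proof. by case: H. Qed.
Let addC : commutative (op : law_group H -> law_group H -> law_group H).
Proof. by case: H. Qed.
Let add0 : left_id law_zero op.
Proof. by rewrite /law_zero; case: cid => e []. Qed.
Let addN : left_inverse law_zero law_opp op.
Proof. by move=> x; rewrite /law_opp; case: cid. Qed.

HB.instance Definition _ := gen_eqMixin (law_group H).
HB.instance Definition _ := gen_choiceMixin (law_group H).
HB.instance Definition _ :=
  GRing.isZmodule.Build (law_group H) addA addC add0 addN.

End LawGroup.

Definition cprod (X Y : cubeset) : cubeset.
Proof.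
refine (@Cubeset (fun n => (X n * Y n)%type)
  (fun _ _ u z => (act u z.1, act u z.2)) _ _).
- by move=> n [x y]; rewrite /= !act_id.
- by move=> m n p u v z; rewrite /= !act_comp.
Defined.

Definition cpr2 (X Y : cubeset) : cmap (cprod X Y) Y :=
  @CMap (cprod X Y) Y (fun _ z => z.2) (fun _ _ _ _ => erefl).

Lemma cpull_act (P Q B : cubeset) (p : cmap P B) (q : cmap Q B) m n
  (u : boxhom m n) (z : {z : P n * Q n | p n z.1 = q n z.2}) :
  p m (act u (sval z).1) = q m (act u (sval z).2).
Proof. by rewrite !mnat (svalP z). Qed.

Definition cpull (P Q B : cubeset) (p : cmap P B) (q : cmap Q B) : cubeset.
Proof.
refine (@Cubeset (fun n => {z : P n * Q n | p n z.1 = q n z.2})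
  (fun m n u z => exist (fun z : P m * Q m => p m z.1 = q m z.2)
     (act u (sval z).1, act u (sval z).2) (cpull_act u z)) _ _).
- by move=> n [[x y] h]; apply: eq_exist; rewrite /= !act_id.
- by move=> m n k u v z; apply: eq_exist; rewrite /= !act_comp.
Defined.

Record cgroup := CGroup {
  gcar :> cubeset;
  gmul : cmap (cprod gcar gcar) gcar;
  gone : cmap cpoint gcar;
  ginv : cmap gcar gcar;
  gmulA : forall n (a b c : gcar n),
    gmul n (a, gmul n (b, c)) = gmul n (gmul n (a, b), c);
  gmul1 : forall n (a : gcar n), gmul n (gone n tt, a) = a;
  gmulV : forall n (a : gcar n), gmul n (ginv n a, a) = gone n tt }.

Definition is_action (G : cgroup) (P : cubeset) (alpha : cmap (cprod G P) P) : Prop :=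
  (forall n (x : P n), alpha n (gone G n tt, x) = x) /\
  (forall n (a b : G n) (x : P n),
     alpha n (gmul G n (a, b), x) = alpha n (a, alpha n (b, x))).

Lemma shear_subproof (G P B : cubeset) (p : cmap P B) (alpha : cmap (cprod G P) P)
  (over : p \oc alpha = p \oc cpr2 G P) n (z : cprod G P n) :
  p n (alpha n z) = p n z.2.
Proof. exact: cmap_congr z over. Qed.

(* The map (alpha, pr_2) : G x P -> P x_B P *)
Definition shear (G P B : cubeset) (p : cmap P B) (alpha : cmap (cprod G P) P)
    (over : p \oc alpha = p \oc cpr2 G P) : cmap (cprod G P) (cpull p p).
Proof.
refine (@CMap (cprod G P) (cpull p p)
  (fun n z => exist (fun w : P n * P n => p n w.1 = p n w.2)
     (alpha n z, z.2) (shear_subproof over z)) _).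
by move=> m n u z; apply: eq_exist; rewrite /= -mnat.
Defined.

Definition is_coequalizer (R P B : cubeset) (f g : cmap R P) (p : cmap P B) : Prop :=
  p \oc f = p \oc g /\
  forall (Z : cubeset) (h : cmap P Z), h \oc f = h \oc g ->
    exists! k : cmap B Z, k \oc p = h.

Definition principal_bundle (G : cgroup) (P B : cubeset) (p : cmap P B)
    (alpha : cmap (cprod G P) P) : Prop :=
  [/\ is_action alpha,
      exists over : p \oc alpha = p \oc cpr2 G P, iso (shear over) &
      is_coequalizer alpha (cpr2 G P) p].

(* The face of {0,1}^n where the coordinates i \in I are fixed to c i; its
   dimension is #|~: I|. *)
Definition face n (I : {set 'I_n}) (c : cube n) : {set cube n} :=
  [set x : cube n | [forall i in I, x i == c i]].

Definition face_fun (A : zmodType) n (a : A) (F : {set cube n}) : {ffun cube n -> A} :=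
  [ffun x => if x \in F then a else 0].

Inductive EM_cell (k : nat) (A : zmodType) (n : nat) : {ffun cube n -> A} -> Prop :=
| EM_face (a : A) (I : {set 'I_n}) (c : cube n) :
    (n - k <= #|~: I|)%N -> EM_cell k (face_fun a (face I c))
| EM_zero : EM_cell k 0
| EM_sub f g : EM_cell k f -> EM_cell k g -> EM_cell k (f - g).

(* A coordinate of an affine map of cubes depends on at most one variable. *)
Lemma affine_coord m n (u : boxhom m n) (j : 'I_n) :
  (forall x y, u x j = u y j) \/
  exists i : 'I_m, forall x y, (u x j == u y j) = (x i == y i).
Proof.
have [A [b hu]] := bfun_affine u.
have {}hu x : ((u x j : nat)%:Z) = \sum_i A j i * (x i : nat)%:Z + b j 0.
  have := congr1 (fun M : 'cV[int]_n => M j 0) (hu x).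
  rewrite !mxE => ->; congr (_ + _); apply: eq_bigr => i _.
  by rewrite mxE.
have [/existsP [i Ai]|/existsPn A0] := boolP [exists i, A j i != 0]; last first.
  left=> x y; have : (u x j : nat)%:Z = (u y j : nat)%:Z.
    by rewrite !hu; congr (_ + _); apply: eq_bigr => i _; move: (A0 i);
      rewrite negbK => /eqP ->; rewrite !mul0r.
  by case: (u x j); case: (u y j).
right; exists i.
have b01 : b j 0 = ((u [ffun=> false] j) : nat)%:Z.
  by rewrite hu big1 ?add0r // => k _; rewrite ffunE mulr0.
have e1 k : A j k + b j 0 = ((u [ffun l => l == k] j) : nat)%:Z.
  rewrite hu (bigD1 k) //= ffunE eqxx mulr1 big1 ?addr0 // => l lk.
  by rewrite ffunE (negbTE lk) mulr0.
have Ak k : k != i -> A j k = 0.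
  move=> ki; have e2 : A j k + A j i + b j 0 =
      ((u [ffun l => (l == k) || (l == i)] j) : nat)%:Z.
    rewrite hu (bigD1 k) //= (bigD1 i) //=; last by rewrite eq_sym.
    rewrite !ffunE !eqxx orbT !mulr1 big1 ?addr0 ?addrA // => l /andP [lk li].
    by rewrite ffunE (negbTE lk) (negbTE li) mulr0.
  move: (e1 i) (e1 k) e2 Ai; rewrite b01.
  move: (A j i) (A j k) => p q.
  case: (u _ j); case: (u _ j); case: (u _ j); case: (u _ j) => /= h1 h2 h3 /eqP h4; lia.
have hx x : ((u x j : nat)%:Z) = A j i * (x i : nat)%:Z + b j 0.
  rewrite hu (bigD1 i) //= big1 ?addr0 // => k ki.
  by rewrite Ak // mul0r.
move=> x y; move: (hx x) (hx y) Ai; move: (A j i) (b j 0) => p q.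
case: (u x j); case: (u y j); case: (x i); case: (y i) => //= h1 h2 /eqP h3;
  exfalso; lia.
Qed.

Lemma face_preim m n (u : boxhom m n) (I : {set 'I_n}) (c : cube n) (z : cube m) :
  u z \in face I c ->
  exists J : {set 'I_m}, (#|J| <= #|I|)%N /\
    forall x, (u x \in face I c) = (x \in face J z).
Proof.
rewrite inE => /forallP /= zI.
have hg j : exists o : option 'I_m, forall x,
    (u x j == u z j) = (if o is Some i then x i == z i else true).
  case: (affine_coord u j) => [h|[i h]]; last by exists (Some i) => x; rewrite h.
  by exists None => x; rewrite (h x z) eqxx.
have [g gP] := choice hg.
exists [set i | Some i \in g @: I]; split.
  apply: leq_trans (leq_imset_card g I).
  rewrite -[leqLHS](@card_imset _ _ Some); last by move=> i i' [].
  apply: subset_leq_card.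
  by apply/subsetP => o /imsetP [i + ->]; rewrite inE.
move=> x; rewrite !inE; apply/forall_inP/forall_inP => /= h.
  move=> i; rewrite inE => /imsetP [j jI ij].
  have := gP j x; rewrite -ij => <-; rewrite (eqP (h j jI)) eq_sym.
  by have := zI j; rewrite jI.
move=> j jI; have /implyP /(_ jI) /eqP <- := zI j; rewrite gP.
case e: (g j) => [i|] //; apply: h; rewrite inE -e; exact: imset_f.
Qed.

Definition ffun_precomp (A : zmodType) m n (u : boxhom m n)
  (f : {ffun cube n -> A}) : {ffun cube m -> A} := [ffun x => f (u x)].

Lemma EM_cell_act k (A : zmodType) m n (u : boxhom m n) (f : {ffun cube n -> A}) :
  EM_cell k f -> EM_cell k (ffun_precomp u f).
Proof.
elim=> {f} [a I c hI||f g _ hf _ hg].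
- have [/existsP [z hz]|/existsPn h0] := boolP [exists z, u z \in face I c].
    have [J [JI hJ]] := face_preim hz.
    rewrite (_ : ffun_precomp _ _ = face_fun a (face J z)).
      apply: EM_face; have := cardsC I; have := cardsC J.
      by rewrite !card_ord; lia.
    by apply/ffunP => x; rewrite !ffunE hJ.
  rewrite (_ : ffun_precomp _ _ = 0); first exact: EM_zero.
  by apply/ffunP => x; rewrite !ffunE (negbTE (h0 x)).
- rewrite (_ : ffun_precomp _ _ = 0); first exact: EM_zero.
  by apply/ffunP => x; rewrite !ffunE.
- rewrite (_ : ffun_precomp _ _ = ffun_precomp u f - ffun_precomp u g).
    exact: EM_sub.
  by apply/ffunP => x; rewrite !ffunE.
Qed.

Definition EM_cubeset (k : nat) (A : zmodType) : cubeset.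
Proof.
refine (@Cubeset (fun n => {f : {ffun cube n -> A} | EM_cell k f})
  (fun m n u f => exist _ (ffun_precomp u (sval f)) (EM_cell_act u (svalP f))) _ _).
- by move=> n [f hf]; apply: eq_exist; apply/ffunP => x; rewrite ffunE.
- by move=> m n p u v [f hf]; apply: eq_exist; apply/ffunP => x; rewrite !ffunE.
Defined.

Lemma EM_cell_opp k (A : zmodType) n (f : {ffun cube n -> A}) :
  EM_cell k f -> EM_cell k (- f).
Proof. by move=> hf; rewrite -[- f]add0r; apply: EM_sub => //; apply: EM_zero. Qed.

Lemma EM_cell_add k (A : zmodType) n (f g : {ffun cube n -> A}) :
  EM_cell k f -> EM_cell k g -> EM_cell k (f + g).
Proof. by move=> hf hg; rewrite -[g]opprK; apply: EM_sub => //; apply: EM_cell_opp. Qed.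

Section EMGroup.
Variables (k : nat) (A : zmodType).

Definition EM_mul : cmap (cprod (EM_cubeset k A) (EM_cubeset k A)) (EM_cubeset k A).
Proof.
refine (@CMap (cprod (EM_cubeset k A) (EM_cubeset k A)) (EM_cubeset k A)
  (fun n z => exist _ (sval z.1 + sval z.2) (EM_cell_add (svalP z.1) (svalP z.2))) _).
by move=> m n u z; apply: eq_exist; apply/ffunP => x; rewrite !ffunE.
Defined.

Definition EM_one : cmap cpoint (EM_cubeset k A).
Proof.
refine (@CMap cpoint (EM_cubeset k A) (fun n _ => exist _ 0 (EM_zero k A n)) _).
by move=> m n u z; apply: eq_exist; apply/ffunP => x; rewrite !ffunE.
Defined.

Definition EM_inv : cmap (EM_cubeset k A) (EM_cubeset k A).
Proof.
refine (@CMap (EM_cubeset k A) (EM_cubeset k A)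
  (fun n f => exist _ (- sval f) (EM_cell_opp (svalP f))) _).
by move=> m n u z; apply: eq_exist; apply/ffunP => x; rewrite !ffunE.
Defined.

Definition EM : cgroup.
Proof.
refine (@CGroup (EM_cubeset k A) EM_mul EM_one EM_inv _ _ _).
- by move=> n a b c; apply: eq_exist; rewrite /= addrA.
- by move=> n [a ha]; apply: eq_exist; rewrite /= add0r.
- by move=> n a; apply: eq_exist; rewrite /= addNr.
Defined.

End EMGroup.

Lemma EM_map_cell k (A B : zmodType) (h : A -> B) (hD : {morph h : x y / x + y})
  n (f : {ffun cube n -> A}) :
  EM_cell k f -> EM_cell k [ffun x => h (f x)].
Proof.
have h0 : h 0 = 0 by apply: (addIr (h 0)); rewrite -hD !add0r.
have hN x : h (- x) = - h x.
  by apply: (addIr (h x)); rewrite -hD !addNr.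
elim=> {f} [a I c hI||f g _ hf _ hg].
- rewrite (_ : [ffun _ => _] = face_fun (h a) (face I c)); first exact: EM_face.
  by apply/ffunP => x; rewrite !ffunE; case: ifP.
- rewrite (_ : [ffun _ => _] = 0); first exact: EM_zero.
  by apply/ffunP => x; rewrite !ffunE.
- rewrite (_ : [ffun _ => _] = [ffun x => h (f x)] - [ffun x => h (g x)]).
    exact: EM_sub.
  by apply/ffunP => x; rewrite !ffunE hD hN.
Qed.

(* D_k(h) : D_k(A) -> D_k(B) *)
Definition EM_map k (A B : zmodType) (h : A -> B) (hD : {morph h : x y / x + y}) :
  cmap (EM k A) (EM k B).
Proof.
refine (@CMap (EM k A) (EM k B)
  (fun n f => exist _ _ (EM_map_cell hD (svalP f))) _).
by move=> m n u z; apply: eq_exist; apply/ffunP => x; rewrite !ffunE.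
Defined.

Definition concrete_ergodic_fibrant (X : cubeset) : Prop :=
  [/\ concrete X, ergodic X & fibrant X].

(* Main.v *)
From HB Require Import structures.
From mathcomp Require Import all_boot all_algebra.
From mathcomp Require Import boolp zify.
Require Import Defs.

(** Write x ~ y for points of a concrete fibrant cubeset when the map sending the
    top vertex of the (n+1)-cube to y and all other vertices to x is a cube.
    Two cubes that agree away from the top have equivalent tops ([sim_agree]), and
    the top of a cube may be exchanged for an equivalent point ([replace_top]);
    both come from assembling 2^k small cubes into a cube of twice the side
    ([tricube]), which in turn is an instance of extending a partial cube from a
    down-closed set of vertices ([extend]).  Hence ~ is an equivalence relation,
    vertices of cubes of dimension at most n+1 may be moved freely within their
    classes, and in higher dimensions the class of the top vertex is determined
    by the others ([nsim_top]).  So X -> X/~ has the right lifting property against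
    corners ([nsim_corner_lifting]), X/~ is concrete, fibrant and n-step, and a map
    from X to an n-step cubeset identifies cubes with equivalent vertices
    ([nsim_nstep]).  Therefore X/~ is the n-th truncation ([nquot_truncation]), and every
    truncation inherits this description ([truncation_nquot]); it applies to the maps
    X -> tau_n X and also to tau_(n+1) X -> tau_n X.

    For the bundle, let Y = tau_(n+1) X.  By ergodicity any two points of Y span an
    edge, so pairs of points form a cube structure too ([arrow]), and the relation ~
    on pairs reads: (x, x') ~ (y, y') when the pair (x, y) is parallel to (x', y').
    Since Y is (n+1)-step, for x ~ y and any x' there is exactly one y'
    with (x, y) parallel to (x', y').  An element a of pi_(n+1) is a point equivalent to
    the base point y0, and a acts on y by the parallel transport of (y0, a) to y.
    The product of pi_(n+1) is this action restricted to the class of y0 ([par_mul]).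
    Each fibre of Y -> tau_n X is a class, hence a torsor.  Transporting a cube over
    a face of codimension at most n+1 yields a cube ([shift_cubes]), so the
    Eilenberg-Mac Lane cubes act on cubes ([opc_cube]).  Conversely, an arbitrary
    function on vertices can be matched on all vertices of weight at most n+1 by an
    Eilenberg-Mac Lane cube, and the remaining vertices of a cube of Y are
    determined by those; so the difference of two cubes with equivalent vertices
    is an Eilenberg-Mac Lane cube ([EM_cell_diff]), and the action is principal. *)

Set Implicit Arguments.
Unset Strict Implicit.
Unset Printing Implicit Defensive.

(** * Cube structures on a set of points *)

Definition istop (I : finType) (x : I -> bool) : bool := [forall i, x i].

Definition top (I : Type) : I -> bool := fun=> true.

Definition clr (I : eqType) (i : I) (x : I -> bool) : I -> bool :=
  fun j => (j != i) && x j.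

Definition meet (I : Type) (w x : I -> bool) : I -> bool := fun i => w i && x i.

(** The maps of vertex sets each of whose coordinates is constant, a coordinate, or the
    negation of one.  On {0,1}^m these are the morphisms of the cube category. *)
Definition adm (I J : Type) (phi : (I -> bool) -> (J -> bool)) : Prop :=
  forall j, (exists b, forall x, phi x j = b) \/
            (exists i b, forall x, phi x j = b (+) x i).

(** The part of a concrete fibrant cubeset that the geometric arguments need: which maps
    from the vertices of a cube to the points are cubes.  Cubes have an arbitrary finite
    type of coordinates, so that products and extra coordinates need no arithmetic on
    dimensions; their vertices are the boolean functions on that type. *)
Record cube_structure (P : Type) := CubeStructure {
  is_cube :> forall I : finType, ((I -> bool) -> P) -> Prop;
  is_cube_pre : forall (I J : finType) (phi : (I -> bool) -> (J -> bool)) f,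
    adm phi -> is_cube f -> is_cube (fun x => f (phi x));
  is_cube_const : forall (I : finType) p, is_cube (fun _ : I -> bool => p);
  is_cube_fill : forall (I : finType) (f : (I -> bool) -> P),
    (forall i, is_cube (fun x => f (clr i x))) ->
    exists2 g, is_cube g & forall x, ~~ istop x -> g x = f x }.

Arguments is_cube {P} c I f.

Lemma is_cube_ext P (C : cube_structure P) (I : finType) (f g : (I -> bool) -> P) :
  (forall x, f x = g x) -> C I f -> C I g.
Proof. by move=> /funext ->. Qed.

Lemma istopP (I : finType) (x : I -> bool) : reflect (x = @top I) (istop x).
Proof.
apply: (iffP forallP) => [h|-> //].
by apply: funext => i; rewrite h.
Qed.

Lemma istop_top (I : finType) : istop (@top I).
Proof. exact/istopP. Qed.

Lemma adm_comp (I J K : Type) (phi : (J -> bool) -> (K -> bool))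
  (psi : (I -> bool) -> (J -> bool)) :
  adm phi -> adm psi -> adm (fun x => phi (psi x)).
Proof.
move=> h1 h2 k; case: (h1 k) => [[b hb]|[j [b hb]]]; first by left; exists b.
case: (h2 j) => [[b' hb']|[i [b' hb']]].
  by left; exists (b (+) b') => x; rewrite hb hb'.
by right; exists i, (b (+) b') => x; rewrite hb hb' addbA.
Qed.

Lemma adm_coord (I J : Type) (phi : (I -> bool) -> (J -> bool)) :
  (forall j, (exists b, forall x, phi x j = b) \/ (exists i, forall x, phi x j = x i)) ->
  adm phi.
Proof.
by move=> h j; case: (h j) => [|[i hi]]; [left|right; exists i, false].
Qed.

Lemma adm_meet (I : Type) (w : I -> bool) : adm (meet w).
Proof.
apply: adm_coord => i; rewrite /meet; case: (w i); last by left; exists false.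
by right; exists i.
Qed.

Lemma adm_pull (I J : Type) (h : J -> I) : adm (fun (x : I -> bool) j => x (h j)).
Proof. by apply: adm_coord => j; right; exists (h j). Qed.

(** The face of the vertices below [w], as a cube on the coordinates of [w]. *)
Definition ext (I : finType) (w : I -> bool) (y : {i | w i} -> bool) : I -> bool :=
  fun i => if insub i is Some j then y j else false.

Section Ext.
Variables (I : finType) (w : I -> bool).
Implicit Types (y : {i | w i} -> bool).

Lemma adm_ext : adm (@ext I w).
Proof.
apply: adm_coord => i; rewrite /ext; case: insubP => [j _ _|_].
  by right; exists j.
by left; exists false.
Qed.

Lemma extE y j : ext y (val j) = y j.
Proof. by rewrite /ext valK. Qed.

Lemma ext_le y i : ext y i -> w i.
Proof. by rewrite /ext; case: insubP. Qed.

Lemma ext_restr x : ext (fun j : {i | w i} => x (val j)) = meet w x.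
Proof.
apply: funext => i; rewrite /ext /meet.
by case: insubP => [j -> <- //|/negbTE ->].
Qed.

Lemma ext_top : ext (@top {i | w i}) = w.
Proof.
by apply: funext => i; rewrite /ext; case: insubP => [j -> //|/negbTE ->].
Qed.

Lemma ext_below y : ~~ istop y -> exists2 i, w i & ~~ ext y i.
Proof.
rewrite negb_forall => /existsP [j yj]; exists (val j); first exact: valP.
by rewrite extE.
Qed.

End Ext.

Section Extension.
Variables (P : Type) (C : cube_structure P).

(** For an equivalence relation [E], the right lifting property of the quotient by [E]
    against corners; for the total relation, the filling of corners. *)
Definition corner_lifting (E : P -> P -> Prop) : Prop :=
  forall (I : finType) (f g : (I -> bool) -> P),
    (forall i, C I (fun x => f (clr i x))) -> C I g ->
    (forall x, ~~ istop x -> E (f x) (g x)) ->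
  exists2 h, C I h & (forall x, ~~ istop x -> h x = f x) /\ E (h (@top I)) (g (@top I)).

Lemma corner_lifting_total : corner_lifting (fun _ _ => True).
Proof. by move=> I f g /is_cube_fill [h hC hf] _ _; exists h. Qed.

(** Corner filling on the coordinates of [w], transported by [ext] and by restriction. *)
Lemma face_fill E (hE : corner_lifting E) (I : finType) (w : I -> bool) f g :
  (forall i, w i -> C I (fun x => f (meet (clr i w) x))) -> C I g ->
  (forall x, (exists2 i, w i & ~~ x i) -> (forall i, x i -> w i) -> E (f x) (g x)) ->
  exists2 p, E p (g w) &
    C I (fun x => if [forall i, w i ==> x i] then p else f (meet w x)).
Proof.
move=> hf hg hfg.
pose J : finType := {i : I | w i}.
have [||x xtop|h hC [hf' hw]] := hE J (fun y => f (ext y)) (fun y => g (ext y)).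
- move=> j; apply: is_cube_ext (is_cube_pre (@adm_ext I w) (hf (val j) (valP j))) => x.
  congr f; apply: funext => i; rewrite /meet /clr /ext.
  case: insubP => [k wk <-|]; last by rewrite andbF.
  by rewrite (valP k) (inj_eq val_inj) andbT.
- exact: is_cube_pre (@adm_ext I w) hg.
- by apply: hfg; [exact: ext_below|exact: ext_le].
exists (h (@top J)); first by move: hw; rewrite [ext _]ext_top.
apply: is_cube_ext (is_cube_pre (adm_pull (val : J -> I)) hC) => x.
case: ifPn => [/forallP wx|wx].
  by congr h; apply: funext => j; have := wx (val j); rewrite (valP j).
rewrite hf' ?ext_restr //; apply: contra wx => /forallP /= h'.
by apply/forallP => i; apply/implyP => wi; apply: (h' (exist _ i wi)).
Qed.

Definition downset (I : Type) (S : (I -> bool) -> Prop) : Prop :=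
  forall x y : I -> bool, (forall i, x i -> y i) -> S y -> S x.

Definition weight (I : finType) (w : I -> bool) : nat := #|[pred i | w i]|.

Lemma weight_lt (I : finType) (v w : I -> bool) i :
  (forall i, v i -> w i) -> w i -> ~~ v i -> (weight v < weight w)%N.
Proof.
move=> vw wi vi; apply: proper_card; apply/properP; split.
  by apply/subsetP => j; apply: vw.
by exists i.
Qed.

Lemma weight_le (I : finType) (v w : I -> bool) :
  (forall i, v i -> w i) -> (weight v <= weight w)%N.
Proof. by move=> vw; apply: subset_leq_card; apply/subsetP => j; apply: vw. Qed.

(** A map that is a cube on every face below a vertex of the down-closed set [S] extends to
    the down-closed set [S'], inside the [E]-classes prescribed by [b]: add the missing
    vertices in the order of their weight, filling one corner for each.  The cases in use
    are [E] total (extension to a cube) and [S] empty (lifting from the quotient by [E]). *)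
Lemma extend E (hE : corner_lifting E) (I : finType) (S S' : (I -> bool) -> Prop) f b :
  (forall x y, E x y -> E y x) -> (forall x y z, E x y -> E y z -> E x z) ->
  downset S -> downset S' ->
  (forall w, S w -> C I (fun x => f (meet w x)) /\ E (f w) (b w)) ->
  (forall w, S' w -> exists2 g, C I g &
     forall x : I -> bool, (forall i, x i -> w i) -> E (b x) (g x)) ->
  exists2 h, (forall w, S w -> h w = f w) &
    forall w, S' w -> C I (fun x => h (meet w x)) /\ E (h w) (b w).
Proof.
move=> Esym Etr dS dS' hf hb.
suff H k : exists2 h, (forall w, S w -> h w = f w) &
    forall w, S' w -> (weight w < k)%N -> C I (fun x => h (meet w x)) /\ E (h w) (b w).
  have [h h1 h2] := H #|I|.+1; exists h => // w hw; apply: h2 => //.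
  by rewrite ltnS max_card.
elim: k => [|k [h h1 h2]]; first by exists f.
have fill w : exists p, S' w -> ~ S w -> weight w = k -> E p (b w) /\
    C I (fun x => if [forall i, w i ==> x i] then p else h (meet w x)).
  case: (pselect (S' w)) => [hw|]; last by exists (f w).
  case: (pselect (weight w = k)) => [wk|]; last by exists (f w).
  have [g gC hg] := hb w hw.
  have [i wi|x [i wi xi] xw|p] := @face_fill E hE I w h g _ gC; last first.
  - by move=> pE pC; exists p => _ _ _; split=> //; apply: Etr pE _; apply/Esym/hg.
  - have xk : (weight x < k)%N by rewrite -wk; apply: weight_lt xi.
    have hx : S' x by apply: dS' hw.
    by apply: Etr (hg _ xw); have [] := h2 x hx xk.
  apply: (proj1 (h2 (clr i w) _ _)).
    by apply: dS' hw => j /andP [].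
  by rewrite -wk; apply: (@weight_lt _ _ _ i) => // [j /andP []|] //; rewrite /clr eqxx.
have [p pP] := choice fill.
pose h' v := if `[< ~ S v /\ weight v = k >] then p v else h v.
have h'E v : S v \/ (weight v < k)%N -> h' v = h v.
  rewrite /h'; case: asboolP => // -[nS vk] [//|]; by rewrite vk ltnn.
exists h' => [w hw|w hw]; first by rewrite h'E ?h1 //; left.
have meetw x i : meet w x i -> w i by case/andP.
rewrite ltnS => wk.
have [hS|nS] := pselect (S w).
  have [fC fE] := hf w hS; split; last by rewrite h'E ?h1 //; left.
  apply: is_cube_ext fC => x; have Sx : S (meet w x) by apply: dS hS; apply: meetw.
  by rewrite h'E ?h1 //; left.
have [wk'|wk'] := ltnP (weight w) k.
  have [fC fE] := h2 w hw wk'; split; last by rewrite h'E //; right.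
  apply: is_cube_ext fC => x; rewrite h'E //; right; apply: leq_ltn_trans wk'.
  exact/weight_le/meetw.
have {wk wk'} wk : weight w = k by apply/eqP; rewrite eqn_leq wk.
have [pE pC] := pP w hw nS wk.
have h'w : h' w = p w by rewrite /h' asboolT.
split; last by rewrite h'w.
apply: is_cube_ext pC => x; case: ifPn => [/forallP wx|].
  rewrite -h'w; congr h'; apply: funext => i; rewrite /meet.
  by have := wx i; case: (w i) => //= ->.
rewrite negb_forall => /existsP [i]; rewrite negb_imply => /andP [wi xi].
rewrite h'E //; right; rewrite -wk; apply: (@weight_lt _ _ _ i) => //; first exact: meetw.
by rewrite /meet negb_and xi orbT.
Qed.

Lemma extend_down (I : finType) (S : (I -> bool) -> Prop) f :
  downset S -> (forall w, S w -> C I (fun x => f (meet w x))) ->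
  exists2 h, C I h & forall w, S w -> h w = f w.
Proof.
move=> dS hf.
have [||||w hw|w _|h h1 h2] :=
    @extend _ corner_lifting_total I S (fun=> True) f f => //.
- by split=> //; apply: hf.
- by exists (fun=> f w) => //; apply: is_cube_const.
exists h => //; by have [] := h2 (@top I) Logic.I.
Qed.

End Extension.

(** * Points that agree up to corners *)

Section Sim.
Variables (P : Type) (C : cube_structure P).

(** A cube of side 2 is glued from the unit cubes around its centre.  The coordinates
    [inl i] and [inr i] run from the centre in the two directions of the axis [i], and a
    choice of directions [s] names one of the unit cubes.  The points where no axis has
    both coordinates set form a down-closed set; extend, then take all antidiagonals. *)
Lemma tricube (I : finType) (F : (I + I -> bool) -> P) :
  (forall s : I -> bool, C _ (fun v => F (fun k => match k with
     | inl i => ~~ s i && v i | inr i => s i && v i end))) ->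
  C _ (fun v => F (fun k => match k with inl i => ~~ v i | inr i => v i end)).
Proof.
move=> hF.
pose S (w : I + I -> bool) := forall i, ~~ (w (inl i) && w (inr i)).
have dS : downset S.
  move=> x y xy hy i; apply: contra (hy i) => /andP [xl xr].
  by rewrite !xy.
have [w wS|h hC hS] := @extend_down P C _ S F dS.
  pose phi (x : I + I -> bool) i :=
    if w (inr i) then x (inr i) else w (inl i) && x (inl i).
  have aphi : adm phi.
    apply: adm_coord => i; rewrite /phi; case: (w (inr i)); first by right; exists (inr i).
    by case: (w (inl i)); [right; exists (inl i)|left; exists false].
  apply: is_cube_ext (is_cube_pre aphi (hF (fun i => w (inr i)))) => x /=.
  congr F; apply: funext => -[i|i]; rewrite /meet /phi; move: (wS i).
    by case: (w (inr i)); rewrite // andbT => /negbTE ->.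
  by case: (w (inr i)).
pose phi (v : I -> bool) (k : I + I) := match k with inl i => ~~ v i | inr i => v i end.
have aphi : adm phi.
  by move=> [i|i]; right; exists i; [exists true|exists false] => x.
apply: is_cube_ext (is_cube_pre aphi hC) => v; apply: hS => i /=.
by case: (v i).
Qed.

Definition sim (I : finType) (x y : P) : Prop :=
  C I (fun v : I -> bool => if istop v then y else x).

Lemma sim_refl I x : sim I x x.
Proof. by apply: is_cube_ext (is_cube_const C I x) => v; case: ifP. Qed.

(** Put [f] on the first unit cube of a cube of side 2, the cube with the top [y] and other
    vertices [f top] on the opposite one, and degenerate cubes on the others. *)
Lemma replace_top (I : finType) (f : (I -> bool) -> P) y :
  C _ f -> sim I (f (@top I)) y -> C _ (fun v => if istop v then y else f v).
Proof.
move=> fC fy.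
pose F (x : I + I -> bool) :=
  if [forall i, x (inr i)] then y else f (fun i => ~~ x (inl i)).
have := @tricube I F; rewrite /F => H.
apply: is_cube_ext (H _) => [v|s].
  by rewrite -/(istop v); case: ifP => // _; congr f; apply: funext => i; rewrite negbK.
have [/istopP -> /=|sN] := boolP (istop s).
  by apply: is_cube_ext fy => v.
have aphi : adm (fun (v : I -> bool) i => ~~ (~~ s i && v i)).
  move=> i; case: (s i) => /=; first by left; exists true.
  by right; exists i, true.
apply: is_cube_ext (is_cube_pre aphi fC) => v /=; case: ifP => // /forallP h.
case/negP: sN; apply/forallP => i; by case/andP: (h i).
Qed.

(** Fold [f] over all unit cubes of a cube of side 2, with the bottom of [f] at the centre, and
    put [g] instead of [f] on the last one: the outer vertices are [f top] except for
    [g top]. *)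
Lemma sim_agree (I : finType) (f g : (I -> bool) -> P) :
  C _ f -> C _ g -> (forall x, ~~ istop x -> f x = g x) -> sim I (f (@top I)) (g (@top I)).
Proof.
move=> fC gC fg.
pose F (x : I + I -> bool) :=
  if [forall i, x (inr i)] then g (@top I) else f (fun i => x (inl i) || x (inr i)).
have := @tricube I F; rewrite /F => H.
apply: is_cube_ext (H _) => [v|s].
  rewrite -/(istop v); case: ifP => // _; congr f; apply: funext => i; exact: orNb.
have [/istopP -> /=|sN] := boolP (istop s).
  apply: is_cube_ext gC => v; rewrite -/(istop v).
  by case: ifPn => [/istopP -> //|/fg <-].
apply: is_cube_ext fC => v /=; case: ifP => [/forallP h|_].
  case/negP: sN; apply/forallP => i; by case/andP: (h i).
by congr f; apply: funext => i; case: (s i); rewrite //= orbF.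
Qed.

Lemma sim_sym I x y : sim I x y -> sim I y x.
Proof.
move=> xy.
have := sim_agree xy (is_cube_const C I x); rewrite istop_top; apply => v.
by move/negbTE ->.
Qed.

Lemma sim_trans I x y z : sim I x y -> sim I y z -> sim I x z.
Proof.
move=> xy yz; have := @replace_top I _ z xy; rewrite istop_top => /(_ yz).
by apply: is_cube_ext => v; case: (istop v).
Qed.

(** The relation whose classes are the points of the n-th truncation. *)
Definition nsim (n : nat) : P -> P -> Prop := sim 'I_n.+1.

(** Turns the vertex [w] of a cube of dimension at most [n.+1] into the top vertex of a cube of
    dimension exactly [n.+1], of which the given cube is a retract. *)
Lemma straighten n (I : finType) (w : I -> bool) : (#|I| <= n.+1)%N ->
  exists (phi : ('I_n.+1 -> bool) -> (I -> bool)) (psi : (I -> bool) -> ('I_n.+1 -> bool)),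
    [/\ adm phi, adm psi, forall x, phi (psi x) = x, phi (@top _) = w &
        forall x, istop (psi x) = [forall i, x i == w i]].
Proof.
move=> In.
pose iota (i : I) : 'I_n.+1 := widen_ord In (enum_rank i).
have iotaI : injective iota.
  by move=> i j /(congr1 val) /= /val_inj /enum_rank_inj.
pose phi (x : 'I_n.+1 -> bool) i := ~~ w i (+) x (iota i).
pose psi (x : I -> bool) k :=
  if [pick i | iota i == k] is Some i then x i == w i else true.
have psiE x i : psi x (iota i) = (x i == w i).
  rewrite /psi; case: pickP => [j /eqP /iotaI -> //|/(_ i)]; by rewrite eqxx.
exists phi, psi; split=> [i|k|x||x].
- by right; exists (iota i), (~~ w i).
- rewrite /psi; case: pickP => [i _|_]; last by left; exists true.
  by right; exists i, (~~ w i) => x; case: (x i); case: (w i).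
- by apply: funext => i; rewrite /phi psiE; case: (x i); case: (w i).
- by apply: funext => i; rewrite /phi; case: (w i).
apply/forallP/forallP => h i; first by rewrite -psiE.
by rewrite /psi; case: pickP.
Qed.

Definition replace (I : finType) (f : (I -> bool) -> P) (w : I -> bool) y :=
  fun v : I -> bool => if [forall i, v i == w i] then y else f v.

Lemma nsim_replace1 n (I : finType) (f : (I -> bool) -> P) w y :
  (#|I| <= n.+1)%N -> C _ f -> nsim n (f w) y -> C _ (replace f w y).
Proof.
move=> In fC fy.
have [phi [psi [aphi apsi phiK phitop psitop]]] := straighten w In.
have := @replace_top 'I_n.+1 (fun x => f (phi x)) y (is_cube_pre aphi fC).
rewrite phitop => /(_ fy) /(is_cube_pre apsi); apply: is_cube_ext => x.
by rewrite phiK psitop.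
Qed.

(** Passes from [f] to [g] by changing one vertex at a time, which preserves cubes;
    [Q] is an invariant of these steps. *)
Lemma nsim_walk n (I : finType) (Q : ((I -> bool) -> P) -> Prop)
    (f g : (I -> bool) -> P) :
  (#|I| <= n.+1)%N ->
  (forall h w y, C _ h -> nsim n (h w) y -> Q h -> Q (replace h w y)) ->
  C _ f -> Q f -> (forall x, nsim n (f x) (g x)) -> C _ g /\ Q g.
Proof.
move=> In Qstep fC fQ fg.
pose mix (s : seq {ffun I -> bool}) v := if finfun v \in s then g v else f v.
have H s : C _ (mix s) /\ Q (mix s).
  elim: s => [|w s [IHC IHQ]]; first by rewrite (_ : mix _ = f).
  have mixw : nsim n (mix s w) (g w).
    by rewrite /mix; case: ifP => _; [exact: sim_refl|exact: fg].
  suff -> : mix (w :: s) = replace (mix s) w (g w).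
    by split; [exact: (nsim_replace1 In)|exact: Qstep].
  apply: funext => x; rewrite /mix /replace inE.
  have -> : (finfun x == w) = [forall i, x i == w i].
    apply/eqP/forallP => [<- i|h]; first by rewrite ffunE.
    by apply/ffunP => i; rewrite ffunE; apply/eqP.
  by case: forallP => //= h; congr g; apply: funext => i; apply/eqP; exact: h.
have -> : g = mix (enum {ffun I -> bool}); last exact: H.
by apply: funext => x; rewrite /mix mem_enum.
Qed.

Lemma nsim_replace n (I : finType) (f g : (I -> bool) -> P) :
  (#|I| <= n.+1)%N -> C _ f -> (forall x, nsim n (f x) (g x)) -> C _ g.
Proof. by move=> In fC fg; have [] := @nsim_walk n I (fun=> True) f g In. Qed.

(** Restrict to a face of dimension [n.+1] through the top vertex and replace there all
    lower vertices of [g] by those of [f]. *)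
Lemma nsim_top n (I : finType) (f g : (I -> bool) -> P) :
  (n < #|I|)%N -> C _ f -> C _ g -> (forall x, ~~ istop x -> nsim n (f x) (g x)) ->
  nsim n (f (@top I)) (g (@top I)).
Proof.
move=> nI fC gC fg.
pose iota (k : 'I_n.+1) : I := enum_val (widen_ord nI k).
have iotaI : injective iota by move=> i j /enum_val_inj /(congr1 val) /= /val_inj.
pose psi (x : 'I_n.+1 -> bool) i := if [pick k | iota k == i] is Some k then x k else true.
have apsi : adm psi.
  apply: adm_coord => i; rewrite /psi; case: pickP => [k _|_]; last by left; exists true.
  by right; exists k.
have psitop : psi (@top _) = @top I by apply: funext => i; rewrite /psi; case: pickP.
have psiN x : ~~ istop x -> ~~ istop (psi x).
  apply: contra => /forallP h; apply/forallP => k; have := h (iota k); rewrite /psi.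
  by case: pickP => [j /eqP /iotaI -> //|/(_ k)]; rewrite eqxx.
have f'C : C _ (fun x => f (psi x)) := is_cube_pre apsi fC.
have g'C : C _ (fun x => g (psi x)) := is_cube_pre apsi gC.
have hC : C _ (fun x => if istop x then g (psi x) else f (psi x)).
  apply: (@nsim_replace n) g'C _; first by rewrite card_ord.
  move=> x; case: ifPn => [_|xN]; first exact: sim_refl.
  by apply: sim_sym; apply: fg; apply: psiN.
have := sim_agree f'C hC; rewrite istop_top psitop; apply => x.
by move/negbTE ->.
Qed.

(** In dimension at most [n.+1], give the lower vertices of [g] the values of [f]; above,
    fill [f], and its top is equivalent to that of [g] by [nsim_top]. *)
Lemma nsim_corner_lifting n : corner_lifting C (nsim n).
Proof.
move=> I f g fC gC fg.
have [In|nI] := leqP #|I| n.+1.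
  exists (fun v => if istop v then g v else f v).
    apply: nsim_replace In gC _ => x; case: ifPn => [_|xN]; first exact: sim_refl.
    by apply: sim_sym; apply: fg.
  by split=> [x /negbTE -> //|]; rewrite istop_top; apply: sim_refl.
have [h hC hf] := is_cube_fill fC; exists h => //; split=> //.
by apply: nsim_top gC _ => // [|x xN]; [apply: ltnW|rewrite hf //; apply: fg].
Qed.

(** A corner in the quotient lifts to a cube: first lift the corner, then fill. *)
Lemma nsim_lift n (I : finType) (f : (I -> bool) -> P) :
  (forall i, exists2 g, C _ g & forall x, nsim n (f (clr i x)) (g x)) ->
  exists2 h, C _ h & forall x, ~~ istop x -> nsim n (h x) (f x).
Proof.
move=> hf.
pose S (x : I -> bool) := ~~ istop x.
have dS : downset S.
  by move=> x y xy; apply: contra => /forallP h; apply/forallP => i; apply: xy.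
have dF : downset (fun _ : I -> bool => False) by [].
have [||w []|w wS|h _ hS] :=
  @extend _ C _ (@nsim_corner_lifting n) I (fun=> False) S f f _ _ dF dS.
- exact: sim_sym.
- exact: sim_trans.
- move: wS; rewrite /S negb_forall => /existsP [i wi].
  have [g gC fg] := hf i; exists g => // x xw; move: (fg x).
  suff -> : clr i x = x by [].
    apply: funext => j; rewrite /clr; case: eqP => //= ->.
    by case E : (x i) => //; move: wi; rewrite xw.
have [i|g gC gh] := @is_cube_fill _ C I h.
  have Si : S (clr i (@top I)).
    by rewrite /S negb_forall; apply/existsP; exists i; rewrite /clr eqxx.
  have [hC _] := hS _ Si; apply: is_cube_ext hC => x; congr h; apply: funext => j.
  by rewrite /meet /clr /top andbT.
by exists g => // x xN; rewrite gh //; case: (hS x xN).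
Qed.

End Sim.

(** * The cube structure of a concrete fibrant cubeset *)

Definition vtx (X : cubeset) n (c : X n) (v : 'I_n -> bool) : X 0 :=
  act (vertex (finfun v)) c.

(** Cubes with coordinates in [I] are pulled back from cells; for ['I_n] they are the
    [n]-cells ([cubes_cell]). *)
Definition cubes (X : cubeset) (I : finType) (f : (I -> bool) -> X 0) : Prop :=
  exists n (c : X n) (phi : (I -> bool) -> ('I_n -> bool)),
    adm phi /\ forall x, f x = vtx c (phi x).

Section AdmBox.
Import GRing.Theory.
Local Open Scope ring_scope.

Lemma adm_boxhom m n (phi : ('I_m -> bool) -> ('I_n -> bool)) :
  adm phi -> exists u : boxhom m n, forall x, u x = finfun (phi x).
Proof.
move=> hphi.
have hg j : exists gb : option 'I_m * bool, forall x,
    phi x j = gb.2 (+) (if gb.1 is Some i then x i else false).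
  case: (hphi j) => [[b hb]|[i [b hb]]]; last by exists (Some i, b).
  by exists (None, b) => x; rewrite hb addbF.
have [g gP] := choice hg.
have aff : affine (fun x : cube m => finfun (phi x) : cube n).
  exists (\matrix_(j, i) (if (g j).1 == Some i then if (g j).2 then - 1 else 1 else 0)),
    (\col_j ((g j).2 : nat)%:Z) => x.
  apply/colP => j; rewrite !mxE !ffunE gP.
  case E: (g j) => [[i|] b] /=.
    rewrite (bigD1 i) //= !mxE E eqxx big1 ?addr0 => [|k ki].
      by case: b {E}; case: (x i).
    rewrite !mxE E /= (_ : (Some i == Some k) = false) ?mul0r //.
    by apply/eqP => -[ik]; rewrite ik eqxx in ki.
  by rewrite big1 ?add0r ?addbF // => k _; rewrite !mxE E mul0r.
by exists (BoxHom aff).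
Qed.

End AdmBox.

Lemma vertexE n (v : cube n) x : vertex v x = v.
Proof. by apply/ffunP => j; rewrite ffunE. Qed.

Lemma bcompE m n p (u : boxhom n p) (v : boxhom m n) x : bcomp u v x = u (v x).
Proof. by []. Qed.

Lemma finfunK (I : finType) (T : Type) (v : {ffun I -> T}) : finfun v = v.
Proof. by apply/ffunP => i; rewrite ffunE. Qed.

Lemma funfin (I : finType) (T : Type) (v : I -> T) : (finfun v : I -> T) = v.
Proof. by apply: funext => i; rewrite ffunE. Qed.

Lemma vtx_act (X : cubeset) m n (u : boxhom m n) (c : X n) v :
  vtx (act u c) v = vtx c (u (finfun v)).
Proof.
rewrite /vtx -act_comp; congr act; apply: boxhom_eq => x.
by rewrite bcompE !vertexE finfunK.
Qed.

Lemma vtx_map (X Y : cubeset) (F : cmap X Y) n (c : X n) v :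
  F 0 (vtx c v) = vtx (F n c) v.
Proof. by rewrite /vtx mnat. Qed.

Lemma vtx0 (X : cubeset) (p : X 0) v : vtx p v = p.
Proof.
rewrite /vtx -[RHS]act_id; congr act; apply: boxhom_eq => x.
by apply/ffunP => -[].
Qed.

Lemma vtx_const (X : cubeset) (p : X 0) n v : vtx (constc p n) v = p.
Proof. by rewrite /constc vtx_act vtx0. Qed.

Lemma vtx_inj (X : cubeset) n (c c' : X n) :
  concrete X -> (forall v, vtx c v = vtx c' v) -> c = c'.
Proof.
move=> hX e; apply: hX; apply: funext => v.
by have := e v; rewrite /vtx (_ : finfun v = v) //; apply/ffunP => i; rewrite ffunE.
Qed.

Lemma cubes_vtx (X : cubeset) n (c : X n) : cubes (vtx c).
Proof. by exists n, c, id; split=> //; apply: (@adm_pull _ _ id). Qed.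

Lemma cubes_cell (X : cubeset) n (f : ('I_n -> bool) -> X 0) :
  cubes f -> exists c : X n, forall v, vtx c v = f v.
Proof.
move=> [m [c [phi [aphi fE]]]].
have [u uE] := adm_boxhom aphi; exists (act u c) => v.
by rewrite vtx_act fE uE !funfin.
Qed.

Lemma cubes_pre (X : cubeset) (I J : finType) (phi : (I -> bool) -> (J -> bool))
    (f : (J -> bool) -> X 0) :
  adm phi -> cubes f -> cubes (fun x => f (phi x)).
Proof.
move=> aphi [n [c [psi [apsi fE]]]].
by exists n, c, (fun x => psi (phi x)); split=> //; apply: adm_comp.
Qed.

Lemma cubes_const (X : cubeset) (I : finType) (p : X 0) :
  cubes (fun _ : I -> bool => p).
Proof.
exists 0, p, (fun _ => @top _); split; first by move=> [].
by move=> x; rewrite vtx0.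
Qed.

Lemma cubes_map (X Y : cubeset) (F : cmap X Y) (I : finType) (f : (I -> bool) -> X 0) :
  cubes f -> cubes (fun x => F 0 (f x)).
Proof.
move=> [n [c [phi [aphi fE]]]]; exists n, (F n c), phi; split=> // x.
by rewrite fE vtx_map.
Qed.

Definition insert n (i : 'I_n.+1) (y : 'I_n -> bool) : 'I_n.+1 -> bool :=
  fun j => if unlift i j is Some j' then y j' else false.

Lemma eps_insert n (i : 'I_n.+1) (x : cube n) : (eps i x : 'I_n.+1 -> bool) = insert i x.
Proof. by apply: funext => j; rewrite /insert ffunE. Qed.

Lemma adm_insert n (i : 'I_n.+1) : adm (insert i).
Proof.
apply: adm_coord => j; rewrite /insert; case: unliftP => [j' _|_].
  by right; exists j'.
by left; exists false.
Qed.

Lemma insert_lift n (i : 'I_n.+1) y k : insert i y (lift i k) = y k.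
Proof. by rewrite /insert liftK. Qed.

Lemma insert_self n (i : 'I_n.+1) y : insert i y i = false.
Proof. by rewrite /insert unlift_none. Qed.

Lemma clr_insert n (i : 'I_n.+1) y : clr i (insert i y) = insert i y.
Proof.
apply: funext => j; rewrite /clr /insert; case: unliftP => [j' ->|->].
  by rewrite eq_sym neq_lift.
by rewrite eqxx.
Qed.

Lemma insert_clr n (i : 'I_n.+1) (x : 'I_n.+1 -> bool) :
  ~~ x i -> insert i (fun j => x (lift i j)) = x.
Proof.
move=> xi; apply: funext => j; rewrite /insert; case: unliftP => [j' -> //|->].
exact/esym/negbTE.
Qed.

Lemma corner_of_faces (X : cubeset) n (f : ('I_n.+1 -> bool) -> X 0) :
  concrete X -> (forall i, cubes (fun x => f (clr i x))) ->
  exists c : cmap (Corner n.+1) X,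
    forall m (u : Corner n.+1 m) v, vtx (c m u) v = f (sval u (finfun v)).
Proof.
move=> hX hf.
have hc i : exists c : X n, forall v, vtx c v = f (insert i v).
  have [c cE] := cubes_cell (cubes_pre (adm_insert i) (hf i)).
  by exists c => v; rewrite cE clr_insert.
have [c cE] := choice hc.
have [|g gE] := @corner_glue n X c.
  move=> i j m v w e; apply: vtx_inj => // x; rewrite !vtx_act !cE -!eps_insert.
  by have := congr1 (fun h : boxhom _ _ => h (finfun x)) e => /= ->.
exists g => m [u hu] x; have [i [v uE]] := hu; rewrite {}uE in hu *.
by rewrite gE vtx_act cE -eps_insert.
Qed.

Lemma corner_vertex n (v : 'I_n -> bool) : ~~ istop v -> in_corner (vertex (finfun v)).
Proof.
rewrite negb_forall => /existsP [i vi]; apply: (@corner_zero 0 n i) => x.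
by rewrite !ffunE; apply/negbTE.
Qed.

Lemma cubes_fill_ord (X : cubeset) n (f : ('I_n -> bool) -> X 0) :
  concrete X -> fibrant X -> (forall i, cubes (fun x => f (clr i x))) ->
  exists2 g, cubes g & forall x, ~~ istop x -> g x = f x.
Proof.
move=> hX fX; case: n f => [|n] f hf.
  exists (fun=> f (@top _)); first exact: cubes_const.
  by move=> x; rewrite negb_forall => /existsP [[]].
have [c cE] := corner_of_faces hX hf.
have [//||l [lc _]] := fX n.+1 _ c (to_point (Box n.+1)).
  exact: cmap_eq.
exists (vtx (l n.+1 (bid n.+1))); first exact: cubes_vtx.
move=> v vN; rewrite /vtx -mnat.
have /= e := cmap_congr (exist _ _ (corner_vertex vN) : Corner n.+1 0) lc.
rewrite [LHS](_ : _ = l 0 (vertex (finfun v))); last first.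
  by congr (l 0 _); apply: boxhom_eq.
rewrite e -[LHS](vtx0 _ (@top _)) cE /=; congr f.
by apply: funext => i; rewrite !ffunE.
Qed.

Lemma cubes_fill (X : cubeset) (I : finType) (f : (I -> bool) -> X 0) :
  concrete X -> fibrant X -> (forall i, cubes (fun x => f (clr i x))) ->
  exists2 g, cubes g & forall x, ~~ istop x -> g x = f x.
Proof.
move=> hX fX hf.
pose p (y : 'I_#|I| -> bool) (i : I) := y (enum_rank i).
pose q (x : I -> bool) (k : 'I_#|I|) := x (enum_val k).
have pq x : p (q x) = x by apply: funext => i; rewrite /p /q enum_rankK.
have [k|g gC gE] := @cubes_fill_ord X _ (fun y => f (p y)) hX fX.
  have := cubes_pre (adm_pull enum_rank : adm p) (hf (enum_val k)).
  congr cubes; apply: funext => y; congr f; apply: funext => i.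
  by rewrite /p /clr -(can_eq (@enum_rankK I)) enum_valK.
exists (fun x => g (q x)); first exact: cubes_pre (adm_pull enum_val : adm q) gC.
move=> x xN; rewrite gE ?pq //; apply: contra xN => /forallP h; apply/forallP => i.
by have := h (enum_rank i); rewrite /q enum_rankK.
Qed.

Definition cubesC (X : cubeset) (hX : concrete X) (fX : fibrant X) : cube_structure (X 0) :=
  @CubeStructure _ (@cubes X) (@cubes_pre X) (@cubes_const X)
    (fun I f => @cubes_fill X I f hX fX).

(** For concrete cubesets, lifting of corners can be checked on vertices. *)
Lemma fibration_concrete (X Y : cubeset) (F : cmap X Y) :
  concrete X -> concrete Y ->
  (forall n (f : ('I_n -> bool) -> X 0) (b : Y n),
     (forall i, cubes (fun x => f (clr i x))) ->
     (forall x, ~~ istop x -> F 0 (f x) = vtx b x) ->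
     exists l : X n, (forall x, ~~ istop x -> vtx l x = f x) /\ F n l = b) ->
  fibration F.
Proof.
move=> hX hY H n n0 c b e.
have Fc m (u : Corner n m) : F m (c m u) = b m (sval u) by apply: (cmap_congr u e).
pose clrc (i : 'I_n) : boxhom n n :=
  coordmap (fun j => if j == i then None else Some j) (fun=> false).
have clrP i : in_corner (clrc i).
  by apply: (@corner_zero _ _ i) => x; rewrite !ffunE eqxx.
pose x0 : X 0 := c 0 (exist _ _ (@corner_zero 0 n (Ordinal n0)
  (vertex [ffun=> false]) (fun x => etrans (ffunE _ _) (ffunE _ _)))).
have hf v : exists p : X 0, forall h : in_corner (vertex (finfun v)), p = c 0 (exist _ _ h).
  have [h|h] := pselect (in_corner (vertex (finfun v : cube n))); last by exists x0.
  exists (c 0 (exist _ _ h)) => h'; congr (c 0 _); exact: eq_exist.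
have [f fE] := choice hf.
have cf m (u : Corner n m) v : vtx (c m u) v = f (sval u (finfun v)).
  rewrite /vtx -mnat.
  have h : in_corner (vertex (finfun (sval u (finfun v)))).
    have := in_corner_act (vertex (finfun v)) (svalP u).
    by congr in_corner; apply: boxhom_eq => x; rewrite bcompE !vertexE finfunK.
  rewrite (fE _ h); congr (c 0 _); apply: eq_exist => /=.
  by apply: boxhom_eq => x; rewrite bcompE !vertexE finfunK.
have [i|x xN|l [lf lb]] := H n f (b n (bid n)).
- have := cubes_vtx (c n (exist _ _ (clrP i))); congr cubes; apply: funext => v.
  rewrite cf /=; congr f; apply: funext => j; rewrite /clr !ffunE.
  by case: eqP => //= _; rewrite ffunE.
- rewrite (fE _ (corner_vertex xN)) Fc /= /vtx -mnat; congr (b 0 _).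
  exact: boxhom_eq.
exists (yo l); split; apply: cmap_eq => m u /=.
  apply: vtx_inj => // v; rewrite vtx_act cf lf //.
  case: (svalP u) => i [w uE]; rewrite negb_forall; apply/existsP; exists i.
  by rewrite uE /= ffunE unlift_none.
by rewrite mnat lb -mnat; congr (b m _); apply: boxhom_eq.
Qed.

(** * Truncations as quotients *)

Section Quotient.
Variables (X : cubeset) (hX : concrete X) (fX : fibrant X) (n : nat).
Let C := cubesC hX fX.
Let E := nsim C n.

(** [q] is the levelwise quotient that identifies cells with equivalent vertices. *)
Definition nquot (Z : cubeset) (q : cmap X Z) : Prop :=
  csurj q /\
  forall m (c c' : X m), q m c = q m c' <-> forall v, E (vtx c v) (vtx c' v).

(** Maps from vertices to classes rather than classes of cells, so that the quotient is
    concrete and functorial by construction. *)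
Definition quot_cell m : Type :=
  {F : ('I_m -> bool) -> X 0 -> Prop | exists c : X m, forall v, F v = E (vtx c v)}.

Lemma quot_act_subproof m p (u : boxhom m p) (F : quot_cell p) :
  exists c : X m, forall v : 'I_m -> bool, sval F (u (finfun v)) = E (vtx c v).
Proof.
by case: F => F [c cE]; exists (act u c) => v; rewrite vtx_act -cE.
Qed.

Definition quot : cubeset.
Proof.
refine (@Cubeset quot_cell (fun m p u F => exist _ _ (quot_act_subproof u F)) _ _).
  move=> m [F hF]; apply: eq_exist; apply: funext => v /=.
  by rewrite funfin.
by move=> m p r u v [F hF]; apply: eq_exist; apply: funext => x /=; rewrite finfunK.
Defined.

Definition quot_unit : cmap X quot.
Proof.
refine (@CMap X quot
  (fun m c => exist _ (fun v => E (vtx c v)) (ex_intro _ c (fun v => erefl))) _).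
by move=> m p u c; apply: eq_exist; apply: funext => v; rewrite vtx_act.
Defined.

Lemma E_eq x y : E x = E y <-> E x y.
Proof.
split=> [->|xy]; first exact: sim_refl.
apply: funext => z; apply: propext; split; last exact: sim_trans.
by apply: sim_trans; apply: sim_sym.
Qed.

Lemma quot_nquot : nquot quot_unit.
Proof.
split=> [m [F [c cE]]|m c c'].
  by exists c; apply: eq_exist; apply: funext => v.
split=> [e v|e].
  by apply/E_eq; apply: (congr1 (fun z : quot m => sval z v) e).
by apply: eq_exist; apply: funext => v; apply/E_eq.
Qed.

Section Interface.
Variables (Z : cubeset) (q : cmap X Z) (hq : nquot q).

Lemma nquot_eq0 x y : q 0 x = q 0 y <-> E x y.
Proof.
rewrite (proj2 hq); split=> [/(_ (@top _))|h v]; by rewrite !vtx0.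
Qed.

Lemma nquot_concrete : concrete Z.
Proof.
move=> m z z' e.
have [c cz] := proj1 hq m z; have [c' cz'] := proj1 hq m z'.
rewrite -cz -cz'; apply/(proj2 hq) => v; apply/nquot_eq0.
rewrite !vtx_map cz cz'; exact: (congr1 (fun h => h (finfun v)) e).
Qed.

Lemma nquot_cubes (I : finType) (f : (I -> bool) -> Z 0) :
  cubes f -> exists2 g, C I g & forall x, q 0 (g x) = f x.
Proof.
move=> [m [z [phi [aphi fE]]]]; have [c cz] := proj1 hq m z.
exists (fun x => vtx c (phi x)); last by move=> x; rewrite vtx_map cz.
by exists m, c, phi.
Qed.

Lemma nquot_fibration : fibration q.
Proof.
apply: fibration_concrete nquot_concrete _ => // m f z fC.
have [b <-] := proj1 hq m z => fb.
have [||h hC [hf ht]] := @nsim_corner_lifting _ C n _ f (vtx b) fC.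
- exact: cubes_vtx.
- by move=> x /fb; rewrite -vtx_map => /nquot_eq0.
have [l lh] := cubes_cell hC; exists l; split=> [x xN|].
  by rewrite lh hf.
apply/(proj2 hq) => v; rewrite lh.
have [/istopP -> //|vN] := boolP (istop v).
by rewrite hf //; apply/nquot_eq0; rewrite fb // vtx_map.
Qed.

Lemma nquot_fibrant : fibrant Z.
Proof.
apply: fibration_concrete nquot_concrete _ _.
  by move=> m [] [].
move=> m f b fC _.
have surj0 v : exists p : X 0, q 0 p = f v by have [p] := proj1 hq 0 (f v); exists p.
have [g gE] := choice surj0.
have [i|h hC hg] := @nsim_lift _ C n _ g.
  have [k kC kE] := nquot_cubes (fC i); exists k => // x.
  by apply/nquot_eq0; rewrite gE kE.
have [l lh] := cubes_cell hC; exists (q m l); split; last by case: b.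
move=> x xN; rewrite -vtx_map lh -gE; apply/nquot_eq0; exact: hg.
Qed.

Lemma nquot_nstep : nstep n Z.
Proof.
apply: nstep_intro => [k c nk|k z z' nk].
  have e : to_point Z \oc c = to_point (Box k) \oc corner_incl k by apply: cmap_eq.
  have [l [lc _]] := nquot_fibrant (leq_ltn_trans (leq0n n) nk) e.
  exists (l k (bid k)) => m u; rewrite -mnat -(cmap_congr u lc) /=.
  by congr (l m _); apply: boxhom_eq.
have [c <-] := proj1 hq k z; have [c' <-] := proj1 hq k z' => e.
have eN v : ~~ istop v -> E (vtx c v) (vtx c' v).
  move=> vN; apply/nquot_eq0; rewrite !vtx_map.
  exact: (e 0 (exist _ _ (corner_vertex vN))).
apply/(proj2 hq) => v; have [/istopP ->|/eN //] := boolP (istop v).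
apply: nsim_top eN; [by rewrite card_ord|exact: cubes_vtx|exact: cubes_vtx].
Qed.

End Interface.

Lemma nstep_corner_eq (Y : cubeset) (F : cmap X Y) k (c c' : X k) :
  nstep n Y -> (n < k)%N -> (forall v, ~~ istop v -> vtx c v = vtx c' v) ->
  F k c = F k c'.
Proof.
move=> hY nk cc'; apply: (nstep_inj hY nk) => m u; rewrite -!mnat; congr (F m _).
apply: vtx_inj => // v; rewrite !vtx_act; apply: cc'.
case: (svalP u) => i [w ->]; rewrite negb_forall; apply/existsP; exists i.
by rewrite ffunE unlift_none.
Qed.

(** In dimension at most [n.+1], the vertices can be changed one at a time, and each change
    is part of a change of the top vertex of an (n+1)-cube, which [F] does not see.
    In higher dimension, the two images have the same corner by induction. *)
Lemma nsim_nstep (Y : cubeset) (F : cmap X Y) m (c c' : X m) :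
  nstep n Y -> (forall v, E (vtx c v) (vtx c' v)) -> F m c = F m c'.
Proof.
move=> hY.
have small k (d d' : X k) : (k <= n.+1)%N ->
    (forall v, E (vtx d v) (vtx d' v)) -> F k d = F k d'.
  move=> kn dd'.
  pose Q (h : ('I_k -> bool) -> X 0) :=
    forall a : X k, (forall v, vtx a v = h v) -> F k a = F k d.
  suff [_ H] : C 'I_k (vtx d') /\ Q (vtx d') by apply/esym/H.
  apply: nsim_walk dd'; first by rewrite card_ord; exact: kn.
  - move=> h w y hC hy Qh a ah.
    have [b bh] := cubes_cell hC; rewrite -(Qh b bh).
    have kn' : (#|'I_k| <= n.+1)%N by rewrite card_ord.
    have [phi [psi [aphi apsi phiK phitop psitop]]] := straighten w kn'.
    have hphiC := is_cube_pre aphi hC.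
    have [e eE] := cubes_cell hphiC.
    have [|e' e'E] := cubes_cell (@replace_top _ C _ _ y hphiC _).
      by rewrite phitop.
    have [u uE] := adm_boxhom apsi.
    have -> : a = act u e'.
      by apply: vtx_inj => // v; rewrite vtx_act e'E uE !funfin psitop phiK ah.
    have -> : b = act u e.
      by apply: vtx_inj => // v; rewrite vtx_act eE uE !funfin phiK bh.
    rewrite !mnat; congr act; apply: nstep_corner_eq hY _ _ => // v /negbTE vN.
    by rewrite e'E eE vN.
  - exact: cubes_vtx.
  - by move=> a ad; congr (F k _); apply: vtx_inj.
elim: m c c' => [|m IH] c c' cc'; first exact: small.
have [mn|nm] := leqP m n; first exact: small.
apply: (nstep_inj hY (leqW nm)) => p [u [i [v uE]]] /=.
rewrite uE !act_comp -!mnat mnat [RHS]mnat; congr act; apply: IH => x.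
by rewrite !vtx_act.
Qed.

Lemma nquot_truncation (Z : cubeset) (q : cmap X Z) : nquot q -> is_truncation n q.
Proof.
move=> hq; split; first exact: nquot_nstep hq.
move=> Y hY F.
pose r m (z : Z m) : X m := sval (cid (proj1 hq m z)).
have rK m z : q m (r m z) = z by rewrite /r; case: cid.
have Fr m c : F m (r m (q m c)) = F m c.
  by apply: nsim_nstep hY _; apply/(proj2 hq); rewrite rK.
have natg m p (u : boxhom m p) (z : Z p) : F m (r m (act u z)) = act u (F p (r p z)).
  by rewrite -{1}(rK p z) -mnat Fr mnat.
exists (CMap natg); split; first by apply: cmap_eq => m c; apply: Fr.
move=> g gF; apply: cmap_eq => m z /=.
by rewrite -{2}(rK m z) -(cmap_congr (r m z) gF).
Qed.

(** Being [nquot] only depends on the map up to isomorphism of the target, and the quotient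
    is one truncation. *)
Lemma truncation_nquot (Z : cubeset) (e : cmap X Z) : is_truncation n e -> nquot e.
Proof.
have [stepQ univQ] := nquot_truncation quot_nquot.
move=> [stepZ univZ].
have [h [he _]] := univZ quot stepQ quot_unit.
have [k [kq _]] := univQ Z stepZ e.
have khK : k \oc h = cid_map Z.
  have [g [_ gU]] := univZ Z stepZ e.
  have <- : g = cid_map Z by apply: gU; apply: cmap_eq.
  apply/esym/gU; apply: cmap_eq => m c /=.
  by have /= -> := cmap_congr c he; apply: (cmap_congr c kq).
have kqE m c : k m (quot_unit m c) = e m c by apply: (cmap_congr c kq).
have heE m c : h m (e m c) = quot_unit m c by apply: (cmap_congr c he).
have [surjQ eqQ] := quot_nquot; split=> [m z|m c c'].
  have [c cE] := surjQ m (h m z); exists c.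
  by rewrite -kqE cE; apply: (cmap_congr z khK).
by rewrite -eqQ; split=> eq; [rewrite -!heE eq|rewrite -!kqE eq].
Qed.

End Quotient.

(** * Parallel pairs of points *)

Section Parallel.
Variables (P : Type) (C : cube_structure P).
Hypothesis edges : forall (I : finType) (i : I) p q, C I (fun x => if x i then q else p).

(** A cube of pairs is a cube with one more coordinate [None], along which the first component
    turns into the second. *)
Definition arrow_cube (I : finType) (f : (I -> bool) -> P * P) : Prop :=
  C (option I) (fun x => let z := f (fun i => x (Some i)) in if x None then z.2 else z.1).

Lemma arrow_pre (I J : finType) (phi : (I -> bool) -> (J -> bool)) f :
  adm phi -> arrow_cube f -> arrow_cube (fun x => f (phi x)).
Proof.
move=> aphi.
pose phi' (x : option I -> bool) o :=
  if o is Some j then phi (fun i => x (Some i)) j else x None.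
have aphi' : adm phi'.
  move=> [j|]; last by right; exists None, false.
  case: (aphi j) => [[b hb]|[i [b hb]]]; first by left; exists b => x; rewrite /phi' hb.
  by right; exists (Some i), b => x; rewrite /phi' hb.
by move/(is_cube_pre aphi'); apply: is_cube_ext.
Qed.

Lemma arrow_const (I : finType) (z : P * P) : arrow_cube (fun _ : I -> bool => z).
Proof. exact: (@edges (option I) None z.1 z.2). Qed.

Lemma arrow_fill (I : finType) (f : (I -> bool) -> P * P) :
  (forall i, arrow_cube (fun x => f (clr i x))) ->
  exists2 g, arrow_cube g & forall x, ~~ istop x -> g x = f x.
Proof.
move=> hf.
pose S (w : option I -> bool) := ~~ istop (fun i => w (Some i)).
have dS : downset S.
  by move=> x y xy; apply: contra => /forallP h; apply/forallP => i; apply: xy.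
pose F (x : option I -> bool) :=
  let z := f (fun i => x (Some i)) in if x None then z.2 else z.1.
have [w|h hC hS] := @extend_down P C _ S F dS.
  rewrite /S negb_forall => /existsP [i wi].
  apply: is_cube_ext (is_cube_pre (adm_meet w) (hf i)) => x.
  rewrite /F {1 3}/meet; suff -> : clr i (fun j => meet w x (Some j)) =
      fun j => meet w x (Some j) by [].
  apply: funext => j.
  by rewrite /clr /meet; case: eqP => // -> /=; rewrite (negbTE wi).
pose at_ (b : bool) (x : I -> bool) o := if o is Some i then x i else b.
exists (fun x => (h (at_ false x), h (at_ true x))) => [|x xN].
  apply: is_cube_ext hC => x /=.
  by case E : (x None); congr h; apply: funext => -[].
rewrite !hS // /F /at_ /=.
rewrite (_ : (fun i => x i) = x); last exact: funext.
by case: (f x).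
Qed.

Definition arrow : cube_structure (P * P) :=
  @CubeStructure _ arrow_cube arrow_pre arrow_const arrow_fill.

(** The pair (x, y) is parallel to (x', y').  Reading this as the relation [sim] between the
    pairs (x, x') and (y, y') makes composition of parallel pairs the transitivity of [sim]. *)
Definition par (I : finType) (x y x' y' : P) : Prop := sim arrow I (x, x') (y, y').

Lemma par_cubeP (I : finType) x y x' y' :
  par I x y x' y' <->
  C (option I) (fun v => if istop (fun i => v (Some i)) then (if v None then y' else y)
                         else (if v None then x' else x)).
Proof.
by rewrite /par /sim /= /arrow_cube; split; apply: is_cube_ext => v /=; case: (istop _).
Qed.

Variable I : finType.

Lemma par_l x y x' y' : par I x y x' y' -> sim C I x y.
Proof.
move=> /par_cubeP.
have am : adm (fun (x : I -> bool) o => if o is Some i then x i else false).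
  by apply: adm_coord => -[i|]; [right; exists i|left; exists false].
move/(is_cube_pre am); apply: is_cube_ext => v.
by rewrite (_ : (fun i => v i) = v) //; apply: funext.
Qed.

Lemma par_sym x y x' y' : par I x y x' y' -> par I x' y' x y.
Proof.
rewrite !par_cubeP.
have am : adm (fun (x : option I -> bool) o => if o is Some i then x (Some i) else ~~ x None).
  by move=> [i|]; right; [exists (Some i), false|exists None, true].
by move/(is_cube_pre am); apply: is_cube_ext => v /=; case: (v None).
Qed.

Lemma par_r x y x' y' : par I x y x' y' -> sim C I x' y'.
Proof. by move/par_sym/par_l. Qed.

(** Two cubes with a common face can be concatenated. *)
Lemma par_trans x y x' y' x'' y'' :
  par I x y x' y' -> par I x' y' x'' y'' -> par I x y x'' y''.
Proof.
rewrite !par_cubeP => h1 h2.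
pose F (u : option (option I) -> bool) :=
  let t := istop (fun i => u (Some (Some i))) in
  if u None then (if t then y'' else x'')
  else if u (Some None) then (if t then y else x) else if t then y' else x'.
(* The coordinate [Some None] runs from the middle to the first pair, [None] from the
   middle to the last one; their antidiagonal joins the two outer pairs. *)
pose S (w : option (option I) -> bool) := ~~ (w None && w (Some None)).
have dS : downset S.
  by move=> u v uv; apply: contra => /andP [u1 u2]; rewrite !uv.
have [w wS|h hC hS] := @extend_down P C _ S F dS.
  have [w0|w0] := boolP (w None).
    have ws : w (Some None) = false by move: wS; rewrite /S w0 => /negbTE.
    have am : adm (fun (x : option (option I) -> bool) o =>
        if o is Some i then meet w x (Some (Some i)) else x None).
      apply: adm_coord => -[i|]; last by right; exists None.
      rewrite /meet; case: (w _); last by left; exists false.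
      by right; exists (Some (Some i)).
    by apply: is_cube_ext (is_cube_pre am h2) => u; rewrite /F /meet w0 ws /=; case: (u None).
  have am : adm (fun (x : option (option I) -> bool) o =>
      if o is Some i then meet w x (Some (Some i)) else ~~ meet w x (Some None)).
    rewrite /meet => -[i|].
      case: (w _); first by right; exists (Some (Some i)), false.
      by left; exists false.
    case: (w _); first by right; exists (Some None), true.
    by left; exists true.
  apply: is_cube_ext (is_cube_pre am h1) => u; rewrite /F.
  rewrite (_ : meet w u None = false) /=; last by rewrite /meet (negbTE w0).
  by case: (meet w u (Some None)).
have am : adm (fun (x : option I -> bool) o =>
    match o with Some (Some i) => x (Some i) | Some None => ~~ x None | None => x None end).
  move=> [[i|]|]; right.
  - by exists (Some i), false.
  - by exists None, true.
  - by exists None, false.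
apply: is_cube_ext (is_cube_pre am hC) => u; rewrite hS; first by rewrite /F; case: (u None).
by rewrite /S; case: (u None).
Qed.

Lemma par_compose x y z x' y' z' :
  par I x y x' y' -> par I y z y' z' -> par I x z x' z'.
Proof. exact: sim_trans. Qed.

Lemma par_diag x x' : par I x x x' x'.
Proof. exact: sim_refl. Qed.

(** The corner of the required cube consists of the given pair and of edges from [x] to [x']. *)
Lemma par_exists x y x' : sim C I x y -> exists y', par I x y x' y'.
Proof.
move=> xy.
pose F (u : option I -> bool) :=
  if u None then x' else if istop (fun i => u (Some i)) then y else x.
have [[i|]|g gC gF] := @is_cube_fill P C _ F.
- apply: is_cube_ext (@edges _ None x x') => v; rewrite /F /clr /=.
  case: ifP => // _; case: ifPn => // /forallP /(_ i).
  by rewrite eqxx.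
- apply: is_cube_ext (is_cube_pre (adm_pull Some) xy) => v; rewrite /F /clr /=.
  by congr (if _ then _ else _).
exists (g (@top _)); apply/par_cubeP; apply: is_cube_ext gC => v.
have [/istopP -> /=|vN] := boolP (istop v).
  by rewrite (_ : istop _) //; apply/forallP.
rewrite gF // /F; case E : (v None); case: ifP => // /forallP h.
by case/negP: vN; apply/forallP => -[].
Qed.

(** Cubes of dimension above [k] are determined by their corners: the [k]-step condition. *)
Definition rigid (k : nat) : Prop := forall (J : finType) (f g : (J -> bool) -> P),
  (k < #|J|)%N -> C J f -> C J g -> (forall x, ~~ istop x -> f x = g x) -> f = g.

Hypothesis rigidC : rigid #|I|.

Lemma par_uniq x y x' y' z : par I x y x' y' -> par I x y x' z -> y' = z.
Proof.
move=> /par_cubeP h1 /par_cubeP h2.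
have e (v : option I -> bool) : ~~ istop v ->
    (if istop (fun i => v (Some i)) then (if v None then y' else y)
     else (if v None then x' else x)) =
    (if istop (fun i => v (Some i)) then (if v None then z else y)
     else (if v None then x' else x)).
  move=> vN; case: ifP => // /forallP h; case E : (v None) => //.
  by case/negP: vN; apply/forallP => -[].
have lt : (#|I| < #|{: option I}|)%N by rewrite card_option.
have := rigidC lt h1 h2 e.
move/(congr1 (fun f => f (@top (option I)))) => /=.
by rewrite (_ : istop _) //; apply/forallP.
Qed.

(** If [T] is the parallel transport of a fixed pair, extend from the vertices over the base
    vertex of [M], where the extra cube is the one from [c] at the base to its transport, and
    from the degenerate cubes [c] below the top of [I].  Restricted to the segment from the
    base to any vertex of [M], the extension shows that its value there is the transport. *)
Lemma shift_cubes (M : finType) (c : (M -> bool) -> P) (T : P -> P) y0 a :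
  (forall y, par I y0 a y (T y)) -> C M c ->
  C (I + M)%type (fun v => if istop (fun i => v (inl i)) then T (c (fun j => v (inr j)))
                      else c (fun j => v (inr j))).
Proof.
move=> hT cC.
pose S (w : I + M -> bool) := istop (fun i => w (inl i)) -> forall j, ~~ w (inr j).
pose F (x : I + M -> bool) :=
  if istop (fun i => x (inl i)) then T (c (fun=> false)) else c (fun j => x (inr j)).
have dS : downset S.
  move=> x y xy yS /forallP xt j; apply: contra (yS _ j); first exact: xy.
  by apply/forallP => i; apply: xy.
have [w wS|h hC hS] := @extend_down P C _ S F dS.
  have [wt|wt] := boolP (istop (fun i => w (inl i))).
    have ct := par_r (hT (c (fun=> false))).
    apply: is_cube_ext (is_cube_pre (adm_pull inl) ct) => x; rewrite /F.
    rewrite (_ : istop (fun i => meet w x (inl i)) = istop (fun i => x (inl i))).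
      case: ifP => // _; congr c; apply: funext => j.
      by rewrite /meet (negbTE (wS wt j)).
    by apply: eq_forallb => i; rewrite /meet (forallP wt).
  have am : adm (fun (x : I + M -> bool) j => meet w x (inr j)).
    by move=> j; apply: (adm_meet w (inr j)).
  apply: is_cube_ext (is_cube_pre am cC) => x; rewrite /F; case: ifP => // /forallP h.
  by case/negP: wt; apply/forallP => i; have /andP [] := h i.
have hN v : ~~ istop (fun i => v (inl i)) -> h v = c (fun j => v (inr j)).
  by move=> vN; rewrite hS /F ?(negbTE vN) // /S (negbTE vN).
apply: is_cube_ext (hC) => v; case: ifPn => [vt|/hN //].
have c0 := hT (c (fun=> false)).
have cv : par I (c (fun=> false)) (T (c (fun=> false))) (c (fun j => v (inr j))) (h v).
  apply/par_cubeP.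
  pose phi (x : option I -> bool) k := match k with
    | inl i => x (Some i) | inr j => x None && v (inr j) end.
  have am : adm phi.
    apply: adm_coord => -[i|j]; first by right; exists (Some i).
    by rewrite /phi; case: (v _); [right; exists None => x; rewrite andbT|
      left; exists false => x; rewrite andbF].
  apply: is_cube_ext (is_cube_pre am hC) => x; case: ifPn => xt.
    case x0 : (x None).
      congr h; apply: funext => -[i|j]; last by rewrite /phi x0.
      by rewrite /phi (forallP xt) (forallP vt).
    rewrite hS; first by rewrite /F xt; congr T.
    by move=> _ j; rewrite /phi x0.
  rewrite hN // /phi; case x0 : (x None) => //.
by apply: par_uniq cv _; apply: par_trans (par_sym c0) (hT _).
Qed.

End Parallel.

(** * Eilenberg-Mac Lane cells acting on cubes *)

(** The action [op] stands for parallel transport: a free action by which cubes can be moved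
    over the top vertex of an independent (n+1)-cube. *)
Section EMAction.
Import GRing.Theory.
Local Open Scope ring_scope.
Variables (P : Type) (C : cube_structure P) (n : nat) (A : zmodType) (op : A -> P -> P).
Hypothesis op0 : forall z, op 0 z = z.
Hypothesis opD : forall a b z, op (a + b) z = op a (op b z).
Hypothesis op_free : forall a b z, op a z = op b z -> a = b.
Hypothesis op_shift : forall a (M : finType) (c : (M -> bool) -> P), C M c ->
  C ('I_n.+1 + M)%type (fun v => if istop (fun i => v (inl i))
    then op a (c (fun j => v (inr j))) else c (fun j => v (inr j))).
Hypothesis rigidC : rigid C n.+1.

Section Cells.
Variable m : nat.

Definition opc (g : {ffun cube m -> A}) (c : ('I_m -> bool) -> P) (v : 'I_m -> bool) : P :=
  op (g (finfun v)) (c v).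

Lemma opc0 c : opc 0 c = c.
Proof. by apply: funext => v; rewrite /opc ffunE op0. Qed.

Lemma opcD f g c : opc (f + g) c = opc f (opc g c).
Proof. by apply: funext => v; rewrite /opc ffunE opD. Qed.

(** Pull the shifted cube back along the map that sends a vertex to itself and to the
    indicators of the at most [n.+1] equations defining the face, padded by [true]. *)
Lemma opc_face a (I : {set 'I_m}) (w : cube m) c :
  (m - n.+1 <= #|~: I|)%N -> C 'I_m c -> C 'I_m (opc (face_fun a (face I w)) c).
Proof.
move=> hI cC.
have In : (#|I| <= n.+1)%N by have := cardsC I; rewrite card_ord; lia.
pose psi (x : 'I_m -> bool) (s : 'I_n.+1 + 'I_m) := match s with
  | inl k => if [pick i | (i \in I) && (index i (enum I) == k)] is Some i
             then x i == w i else true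
  | inr i => x i end.
have apsi : adm psi.
  move=> [k|i]; last by right; exists i, false.
  rewrite /psi; case: pickP => [i _|_]; last by left; exists true.
  by right; exists i, (~~ w i) => x; case: (x i); case: (w i).
apply: is_cube_ext (is_cube_pre apsi (op_shift a cC)) => x /=.
rewrite (_ : (fun j => x j) = x); last exact: funext.
rewrite /opc ffunE (_ : istop _ = (finfun x \in face I w)).
  by case: ifP => // _; rewrite op0.
rewrite inE; apply/forallP/forall_inP => [h i iI|h k].
  rewrite ffunE.
  have lt : (index i (enum I) < n.+1)%N.
    by apply: leq_trans In; rewrite cardE index_mem mem_enum.
  have := h (Ordinal lt); case: pickP => [j /andP [jI /eqP /= ji]|/(_ i)].
    suff -> : j = i by [].
    by rewrite -(nth_index i (_ : j \in enum I)) ?ji ?nth_index ?mem_enum.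
  by rewrite iI eqxx.
case: pickP => // i /andP [iI _]; by have := h i iI; rewrite ffunE.
Qed.

Lemma opc_cube (g : {ffun cube m -> A}) c :
  EM_cell n.+1 g -> C 'I_m c -> C 'I_m (opc g c).
Proof.
move=> hg; suff H c' : C 'I_m c' -> C 'I_m (opc g c') /\ C 'I_m (opc (- g) c').
  by case/H.
elim: hg c' => {g} [a I w hI|c' c'C|f g _ IHf _ IHg c' c'C].
- move=> c' c'C; split; first exact: opc_face.
  rewrite (_ : - _ = face_fun (- a) (face I w)); first exact: opc_face.
  by apply/ffunP => x; rewrite !ffunE; case: ifP; rewrite ?oppr0.
- by rewrite oppr0 opc0.
- rewrite opprB !opcD; split.
    by apply: (proj1 (IHf _ _)); apply: (proj2 (IHg _ _)).
  by apply: (proj1 (IHg _ _)); apply: (proj2 (IHf _ _)).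
Qed.

(** For the vertices of weight [l], correct the values by the functions supported on the
    faces above them; this does not affect the vertices of smaller weight. *)
Lemma EM_cell_low k (g : {ffun cube m -> A}) :
  exists2 h, EM_cell k h & forall v : cube m, (weight v <= k)%N -> h v = g v.
Proof.
suff H l : (l <= k.+1)%N ->
    exists2 h, EM_cell k h & forall v : cube m, (weight v < l)%N -> h v = g v.
  exact: (H k.+1).
elim: l => [|l IH] lk; first by exists 0 => //; exact: EM_zero.
have [h hEM hg] := IH (ltnW lk).
pose F (w : cube m) := face_fun (g w - h w) (face [set i | w i] [ffun=> true]).
exists (h + \sum_(w : cube m | weight w == l) F w).
  apply: EM_cell_add => //; apply: (big_ind (@EM_cell k A m)).
  - exact: EM_zero.
  - by move=> x y; apply: EM_cell_add.
  - move=> w /eqP wl; apply: EM_face.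
    have := cardsC [set i | w i]; rewrite card_ord.
    have -> : #|[set i | w i]| = l by rewrite -wl; apply: eq_card => i; rewrite !inE.
    by move=> e; rewrite leq_subLR -[leqLHS]e leq_add2r.
have inF (w v : cube m) : (v \in face [set i | w i] [ffun=> true]) -> forall i, w i -> v i.
  rewrite inE => /forall_inP H i wi; have := H i; rewrite inE ffunE => /(_ wi).
  by move/eqP.
move=> v; rewrite ltnS leq_eqVlt => /orP [/eqP vl|vl]; rewrite ffunE sum_ffunE.
  rewrite (bigD1 v) ?vl //= big1 ?addr0 => [|w /andP [/eqP wl wv]].
    rewrite ffunE ifT; first by rewrite addrC subrK.
    by rewrite inE; apply/forall_inP => i; rewrite inE ffunE => ->.
  rewrite ffunE; case: ifP => // /inF wlev; case/eqP: wv; apply/ffunP => i.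
  case wi : (w i); first by rewrite wlev.
  apply/esym/negbTE/negP => vi.
  by have := weight_lt wlev vi (negbT wi); rewrite wl vl ltnn.
rewrite big1 ?addr0 ?hg // => w /eqP wl; rewrite ffunE; case: ifP => // /inF wlev.
by have := weight_le wlev; rewrite wl leqNgt vl.
Qed.

(** A vertex of weight above [n.+1] is the top of a face of dimension above [n.+1]. *)
Lemma rigid_low (f g : ('I_m -> bool) -> P) :
  C 'I_m f -> C 'I_m g -> (forall v, (weight v <= n.+1)%N -> f v = g v) -> f = g.
Proof.
move=> fC gC fg; apply: funext => v.
have [k] := ubnP (weight v); elim: k v => // k IH w; rewrite ltnS => wk.
have [/fg //|nw] := leqP (weight w) n.+1.
have := rigidC _ (is_cube_pre (@adm_ext _ w) fC) (is_cube_pre (@adm_ext _ w) gC).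
rewrite card_sig => /(_ nw) H; rewrite -(ext_top w).
apply: (congr1 (fun h => h (@top _)) (H _)) => y /ext_below [i wi yi].
by apply: IH; apply: leq_trans wk; apply: weight_lt yi => //; apply: ext_le.
Qed.

(** [g] agrees in low weight with an Eilenberg-Mac Lane cube [h], and the cubes [opc g c] and
    [opc h c] are determined by their vertices of low weight. *)
Lemma EM_cell_diff (g : {ffun cube m -> A}) c :
  C 'I_m c -> C 'I_m (opc g c) -> EM_cell n.+1 g.
Proof.
move=> cC gcC; have [h hEM hg] := EM_cell_low n.+1 g.
suff -> : g = h by [].
have e : opc h c = opc g c.
  apply: rigid_low gcC _ => [|v vn]; first exact: opc_cube.
  by rewrite /opc hg // funfin.
apply/ffunP => v; have := congr1 (fun f => f (v : 'I_m -> bool)) e.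
by rewrite /opc finfunK => /op_free.
Qed.

End Cells.
End EMAction.

(** * The structure group and its action *)

Lemma nstep_rigid (Y : cubeset) (hY : concrete Y) (fY : fibrant Y) n :
  nstep n Y -> rigid (cubesC hY fY) n.
Proof.
move=> sY J f g nJ fC gC fg.
pose p (y : 'I_#|J| -> bool) (i : J) := y (enum_rank i).
have ap : adm p := adm_pull enum_rank.
have [c cE] := cubes_cell (cubes_pre ap fC).
have [c' c'E] := cubes_cell (cubes_pre ap gC).
have cc' : c = c'.
  apply: (@nstep_corner_eq Y hY n Y (cid_map Y) _ c c' sY nJ) => v vN.
  rewrite cE c'E fg //; apply: contra vN => /forallP h; apply/forallP => k.
  by have := h (enum_val k); rewrite /p enum_valK.
apply: funext => x.
rewrite -[x](_ : p (fun k => x (enum_val k)) = x) -?cE -?c'E ?cc' //.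
by apply: funext => i; rewrite /p enum_rankK.
Qed.

Section Group.
Variables (Y : cubeset) (hY : concrete Y) (fY : fibrant Y) (n : nat).
Hypothesis sY : nstep n.+1 Y.
Let C := cubesC hY fY.
Hypothesis edges : forall (I : finType) (i : I) p q, C I (fun x => if x i then q else p).
Variable y0 : Y 0.
Local Notation par := (par edges 'I_n.+1).

Let rigidI : rigid C #|'I_n.+1|.
Proof. by rewrite card_ord; apply: nstep_rigid. Qed.

(** The cells of [pi] have the value [y0] away from the top vertex; [pt] identifies them with
    the points equivalent to [y0]. *)
Definition pt (a : pi n.+1 y0) : Y 0 := vtx (sval a) (@top _).

Lemma pi_vtx (a : pi n.+1 y0) v : vtx (sval a) v = if istop v then pt a else y0.
Proof.
have [/istopP -> //|vN] := boolP (istop v).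
have := svalP a 0 (exist _ _ (corner_vertex vN)).
by rewrite /vtx /= => ->; rewrite -[LHS](vtx0 _ (@top _)) vtx_const.
Qed.

Lemma pt_sim a : nsim C n y0 (pt a).
Proof. by apply: is_cube_ext (cubes_vtx (sval a) : C _ _) => v; rewrite pi_vtx. Qed.

Lemma pt_inj : injective pt.
Proof.
move=> a b ab; have : sval a = sval b by apply: vtx_inj => // v; rewrite !pi_vtx ab.
by case: a b {ab} => [a ha] [b hb] /= e; apply: eq_exist.
Qed.

Lemma pt_surj y : nsim C n y0 y -> exists a, pt a = y.
Proof.
move=> /cubes_cell [c cE].
have hc m (u : Corner n.+1 m) : act (sval u) c = constc y0 m.
  apply: vtx_inj => // v; rewrite vtx_act cE vtx_const ifF //.
  apply/negbTE; case: (svalP u) => i [w ->]; rewrite negb_forall.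
  by apply/existsP; exists i; rewrite ffunE unlift_none.
by exists (exist _ c hc); rewrite /pt /= cE istop_top.
Qed.

Lemma vtx_eps m (c : Y m.+1) (i : 'I_m.+1) v : vtx (act (eps i) c) v = vtx c (insert i v).
Proof. by rewrite vtx_act eps_insert funfin. Qed.

(** The cube [d] that defines the product, and the cube [b] made degenerate in the second
    direction, agree as cubes of pairs along the first direction, except at the top, where
    their pairs are ([pt a], [pt (a * b)]) and ([y0], [pt b]). *)
Lemma par_mul a b : par y0 (pt a) (pt b) (pt (pi_mul sY a b)).
Proof.
rewrite /pi_mul; case: cid => d [d0 d1 di] /=.
rewrite [X in par _ _ _ X](_ : _ = vtx d (@top _)); last first.
  by rewrite /pt /= vtx_act; congr vtx; apply: funext => j; rewrite !ffunE.
(* [d] has the coordinates [t] and then [v]; those of [b] are [t] and then [v] without its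
   first coordinate, along which [b] is made degenerate. *)
pose phi (t : bool) (v : 'I_n.+1 -> bool) (j : 'I_n.+2) :=
  if unlift ord0 j is Some k then v k else t.
pose chi (t : bool) (v : 'I_n.+1 -> bool) (k : 'I_n.+1) := if k == ord0 then t else v k.
have phi0 v : vtx d (phi false v) = vtx (sval a) v by rewrite -d0 vtx_eps.
have fC : arrow edges 'I_n.+1 (fun v => (vtx d (phi false v), vtx d (phi true v))).
  pose phi' (x : option 'I_n.+1 -> bool) := phi (x None) (fun k => x (Some k)).
  have am : adm phi'.
    apply: adm_coord => j; rewrite /phi' /phi.
    by case: unliftP => [k _|_]; right; [exists (Some k)|exists None].
  apply: is_cube_ext (is_cube_pre am (cubes_vtx d : C _ _)) => x.
  by rewrite /phi'; case: (x None).
have gC : arrow edges 'I_n.+1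
    (fun v => (vtx (sval b) (chi false v), vtx (sval b) (chi true v))).
  pose chi' (x : option 'I_n.+1 -> bool) := chi (x None) (fun k => x (Some k)).
  have am : adm chi'.
    apply: adm_coord => k; rewrite /chi' /chi.
    by case: (k == ord0); right; [exists None|exists (Some k)].
  apply: is_cube_ext (is_cube_pre am (cubes_vtx (sval b) : C _ _)) => x.
  by rewrite /chi'; case: (x None).
have chiF v : vtx (sval b) (chi false v) = y0.
  by rewrite pi_vtx ifF //; apply/negbTE/forallPn; exists ord0; rewrite /chi eqxx.
have := sim_agree gC fC; rewrite /par /sim /=.
rewrite chiF phi0 -/(pt a) (_ : chi true _ = @top _); last first.
  by apply: funext => k; rewrite /chi; case: ifP.
rewrite (_ : phi true _ = @top _); last first.
  by apply: funext => j; rewrite /phi; case: unlift.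
apply => v vN; rewrite chiF phi0 pi_vtx (negbTE vN); congr pair.
have [j /negbTE vj] := existsP (etrans (esym (negb_forall _)) vN).
have [v0|v0] := boolP (v ord0); last first.
  rewrite -d1 vtx_eps; congr vtx; apply: funext => k.
  case: (unliftP (1%R : 'I_n.+2) k) => [k'|] ->; last first.
    rewrite insert_self (_ : 1%R = lift ord0 ord0); last exact: val_inj.
    by rewrite /phi liftK (negbTE v0).
  rewrite insert_lift /chi; case: eqP => [->|/eqP k'0].
    by rewrite (_ : lift _ _ = ord0) /phi ?unlift_none //; apply: val_inj.
  rewrite (_ : lift _ k' = lift ord0 k') /phi ?liftK //; apply: val_inj.
  by rewrite /= /bump /= lt0n; move: k'0; rewrite -val_eqE /= => ->.
rewrite pi_vtx ifF; last first.
  apply/negbTE/forallPn; exists j; rewrite /chi vj; case: eqP => // j0.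
  by move: vj; rewrite j0 v0.
have j0 : (0 < j)%N by rewrite lt0n; apply/eqP => /(@ord_inj _ j ord0) j0; rewrite j0 v0 in vj.
have := di (lift ord0 j); rewrite lift0 ltnS => /(_ j0) dj.
rewrite -[LHS](vtx_const y0 (fun k => phi true v (lift (lift ord0 j) k))) -dj vtx_eps.
by rewrite insert_clr // /phi liftK vj.
Qed.

Lemma par_comp a b ab y z w :
  par y0 a b ab -> par y0 b y z -> par y0 a z w -> par y0 ab y w.
Proof.
move=> h1 h2 h3; apply: par_compose h2 _.
exact: par_trans (par_sym h1) h3.
Qed.

Lemma pi_mulA : associative (pi_mul sY (y0 := y0)).
Proof.
move=> a b c; apply: pt_inj; apply: (par_uniq rigidI) (par_mul _ _).
exact: par_comp (par_mul a b) (par_mul b c) (par_mul _ _).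
Qed.

Definition swap (j : 'I_n.+2) : 'I_n.+2 :=
  if j == ord0 then 1%R else if j == 1%R then ord0 else j.

Lemma swapK : involutive swap.
Proof.
move=> j; rewrite /swap; have [->|j0] := eqVneq j ord0; first by rewrite eqxx.
by have [->|j1] := eqVneq j 1%R; rewrite ?eqxx // (negbTE j0) (negbTE j1).
Qed.

Lemma insert_swap0 y j : insert ord0 y (swap j) = insert (1%R : 'I_n.+2) y j.
Proof.
rewrite /swap; have [->|j0] := eqVneq j ord0.
  rewrite (_ : 1%R = lift ord0 ord0); last exact: val_inj.
  rewrite insert_lift [in RHS](_ : ord0 = lift (lift ord0 ord0) ord0) ?insert_lift //.
  exact: val_inj.
have [->|j1] := eqVneq j 1%R; first by rewrite !insert_self.
case: (unliftP (1%R : 'I_n.+2) j) j0 j1 => [k ->|->]; last by rewrite eqxx.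
rewrite insert_lift => k0 _.
rewrite (_ : lift _ k = lift ord0 k) ?insert_lift //; apply: val_inj.
move: k0; rewrite -val_eqE /= /bump /=.
by case: (val k).
Qed.

Lemma insert_swap1 y j : insert (1%R : 'I_n.+2) y (swap j) = insert ord0 y j.
Proof. by rewrite -insert_swap0 swapK. Qed.

Lemma mul_cube_swap (a b : pi n.+1 y0) d : mul_cube a b d ->
  mul_cube b a (act (coordmap (fun j => Some (swap j)) (fun=> false)) d).
Proof.
move=> [d0 d1 di]; set sw := coordmap _ _.
have vtx_sw v : vtx (act sw d) v = vtx d (fun j => v (swap j)).
  by rewrite vtx_act; congr vtx; apply: funext => j; rewrite !ffunE.
split=> [||i i1].
- apply: vtx_inj => // v; rewrite vtx_eps vtx_sw -d1 vtx_eps; congr vtx.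
  by apply: funext => j; rewrite insert_swap0.
- apply: vtx_inj => // v; rewrite vtx_eps vtx_sw -d0 vtx_eps; congr vtx.
  by apply: funext => j; rewrite insert_swap1.
have [w wE] : exists w, bcomp sw (eps i) = bcomp (eps i) w.
  apply: zero_factor => x; rewrite bcompE ffunE /swap.
  by rewrite -!val_eqE /=; case: (val i) i1 => [|[|k]] //= _; rewrite ffunE unlift_none.
by rewrite -act_comp wE act_comp di // act_constc.
Qed.

Lemma pi_mulC : commutative (pi_mul sY (y0 := y0)).
Proof.
move=> a b; rewrite /pi_mul; case: cid => d hd; case: cid => d' hd'.
apply: eq_exist => /=; rewrite -(mul_cube_uniq sY (mul_cube_swap hd) hd') -act_comp.
congr act; apply: boxhom_eq => x; apply/ffunP => j; rewrite bcompE !ffunE.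
rewrite /swap; have [->|j0] := eqVneq j ord0.
  by rewrite (_ : 1%R = lift ord0 ord0) ?liftK ?unlift_none //; apply: val_inj.
have [->|//] := eqVneq j 1%R.
by rewrite (_ : 1%R = lift ord0 ord0) ?liftK ?unlift_none //; apply: val_inj.
Qed.

Lemma pt_const : pt (pi_const y0 n.+1) = y0.
Proof. exact: vtx_const. Qed.

Lemma pi_abelian_law : abelian_law (pi_mul sY (y0 := y0)).
Proof.
split; [exact: pi_mulA|exact: pi_mulC|exists (pi_const y0 n.+1); split=> [b|a]].
  apply: pt_inj; apply: (par_uniq rigidI) (par_mul _ _) _.
  by rewrite pt_const; apply: par_diag.
have [b' hb'] := par_exists edges y0 (sim_sym (pt_sim a)).
have [b bE] := pt_surj (par_r hb').
exists b; apply: pt_inj; apply: (par_uniq rigidI) (par_mul _ _) _.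
by rewrite pt_const bE; apply: par_sym.
Qed.

Variable H : abelian_law (pi_mul sY (y0 := y0)).
Let A := law_group H.

(** Parallel transport of the pair ([y0], [pt a]) to [z]. *)
Definition translate (a : A) (z : Y 0) : Y 0 := sval (cid (par_exists edges z (pt_sim a))).

Lemma translateP (a : A) z : par y0 (pt a) z (translate a z).
Proof. by rewrite /translate; case: cid. Qed.

Lemma translate_uniq (a : A) z w : par y0 (pt a) z w -> translate a z = w.
Proof. exact: (par_uniq rigidI) (translateP a z). Qed.

Lemma pt_zero : pt (0%R : A) = y0.
Proof.
have e : pi_mul sY (pi_const y0 n.+1) (0%R : A) = 0%R :> A.
  apply: pt_inj; apply: (par_uniq rigidI) (par_mul _ _) _.
  by rewrite pt_const; apply: par_diag.
have := GRing.addr0 (pi_const y0 n.+1 : A).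
by rewrite [LHS]e => ->; apply: pt_const.
Qed.

Lemma translate0 z : translate 0%R z = z.
Proof. by apply: translate_uniq; rewrite pt_zero; apply: par_diag. Qed.

Lemma translateD (a b : A) z : translate (a + b)%R z = translate a (translate b z).
Proof.
apply: translate_uniq; exact: par_comp (par_mul a b) (translateP _ _) (translateP _ _).
Qed.

Lemma translate_free (a b : A) z : translate a z = translate b z -> a = b.
Proof.
move=> e; apply: pt_inj; apply: (par_uniq rigidI) (par_sym (translateP a z)) _.
by rewrite e; apply/par_sym/translateP.
Qed.

Lemma translate_sim (a : A) z : nsim C n z (translate a z).
Proof. exact: par_r (translateP a z). Qed.

Lemma translate_trans z w : nsim C n z w -> exists a : A, translate a z = w.
Proof.
move=> zw; have [y hy] := par_exists edges y0 zw.
have [a aE] := pt_surj (par_r hy); exists a.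
by apply: translate_uniq; rewrite aE; apply: par_sym.
Qed.

Lemma translate_shift (a : A) (M : finType) (c : (M -> bool) -> Y 0) : C M c ->
  C ('I_n.+1 + M)%type (fun v => if istop (fun i => v (inl i))
    then translate a (c (fun j => v (inr j))) else c (fun j => v (inr j))).
Proof. exact: (shift_cubes rigidI (translateP a)). Qed.

Let act_exists m (g : EM n.+1 A m) (c : Y m) :
  exists d : Y m, forall v, vtx d v = opc translate (sval g) (vtx c) v.
Proof.
apply: cubes_cell; apply: (@opc_cube _ C n _ _ translate0 translateD translate_shift).
  exact: svalP.
exact: cubes_vtx.
Qed.

Definition EM_act_cell m (z : cprod (EM n.+1 A) Y m) : Y m :=
  sval (cid (act_exists z.1 z.2)).

Lemma vtx_EM_act_cell m z v :
  vtx (@EM_act_cell m z) v = translate (sval z.1 (finfun v)) (vtx z.2 v).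
Proof. by rewrite /EM_act_cell; case: cid => d /= ->. Qed.

Definition EM_act : cmap (cprod (EM n.+1 A) Y) Y.
Proof.
refine (@CMap (cprod (EM n.+1 A) Y) Y EM_act_cell _).
move=> m p u z; apply: vtx_inj => // v.
by rewrite vtx_act !vtx_EM_act_cell /= ffunE vtx_act finfunK.
Defined.

Lemma vtx_EM_act m z v :
  vtx (EM_act m z) v = translate (sval z.1 (finfun v)) (vtx z.2 v).
Proof. exact: vtx_EM_act_cell. Qed.

End Group.

(** Maps of cubesets preserve parallel pairs. *)
Lemma translate_nat (Y Y' : cubeset) (hY : concrete Y) (fY : fibrant Y)
    (hY' : concrete Y') (fY' : fibrant Y') n (sY : nstep n.+1 Y) (sY' : nstep n.+1 Y')
    edges edges' (F : cmap Y Y') (y0 : Y 0) (y0' : Y' 0) (e : F 0 y0 = y0')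
    (H : abelian_law (pi_mul sY (y0 := y0))) (H' : abelian_law (pi_mul sY' (y0 := y0')))
    (a : law_group H) z :
  F 0 (@translate Y hY fY n sY edges y0 H a z) =
  @translate Y' hY' fY' n sY' edges' y0' H' (pi_map e a) (F 0 z).
Proof.
apply/esym/translate_uniq/par_cubeP.
have := cubes_map F ((proj1 (par_cubeP _ _ _ _ _ _)) (translateP edges a z)).
apply: (@is_cube_ext _ (cubesC hY' fY')) => v.
have <- : F 0 (pt a) = pt (pi_map e a : pi n.+1 y0') by rewrite /pt vtx_map.
by rewrite -e; case: (istop _); case: (v None).
Qed.

(** * The tower *)

Lemma iso_bij (X Y : cubeset) (F : cmap X Y) :
  (forall n, injective (F n)) -> csurj F -> iso F.
Proof.
move=> inj surj.
pose r m (y : Y m) : X m := sval (cid (surj m y)).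
have rK m y : F m (r m y) = y by rewrite /r; case: cid.
have rnat m p (u : boxhom m p) y : r m (act u y) = act u (r p y).
  by apply: inj; rewrite mnat !rK.
exists (CMap rnat); split; apply: cmap_eq => m x; last exact: rK.
by apply: inj; apply: rK.
Qed.

(** A levelwise quotient map of presheaves is a coequalizer. *)
Lemma csurj_coequalizer (R P B : cubeset) (f g : cmap R P) (p : cmap P B) :
  csurj p -> p \oc f = p \oc g ->
  (forall n (x y : P n), p n x = p n y -> exists r : R n, f n r = x /\ g n r = y) ->
  is_coequalizer f g p.
Proof.
move=> surj pfg ker; split=> // Z h hfg.
pose s m (b : B m) : P m := sval (cid (surj m b)).
have sK m b : p m (s m b) = b by rewrite /s; case: cid.
have hs m x : h m (s m (p m x)) = h m x.
  by have [r [<- <-]] := ker m _ _ (sK m (p m x)); apply: (cmap_congr r hfg).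
have knat m q (u : boxhom m q) b : h m (s m (act u b)) = act u (h q (s q b)).
  by rewrite -mnat -(hs _ (act u _)) mnat sK.
exists (CMap knat); split; first by apply: cmap_eq => m x; apply: hs.
move=> k kp; apply: cmap_eq => m b /=.
by have /= <- := cmap_congr (s m b) kp; rewrite sK.
Qed.

Section Bundle.
Variables (Y : cubeset) (hY : concrete Y) (fY : fibrant Y) (n : nat).
Hypothesis sY : nstep n.+1 Y.
Hypothesis edges : forall (I : finType) (i : I) p q,
  cubesC hY fY I (fun x => if x i then q else p).
Variables (y0 : Y 0) (H : abelian_law (pi_mul sY (y0 := y0))).
Variables (Z : cubeset) (e : cmap Y Z) (he : nquot hY fY n e).
Let A := law_group H.
Let alpha : cmap (cprod (EM n.+1 A) Y) Y := EM_act edges H.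

Lemma EM_act_over : e \oc alpha = e \oc cpr2 (EM n.+1 A) Y.
Proof.
apply: cmap_eq => m z; apply/(proj2 he) => v; rewrite vtx_EM_act.
exact/sim_sym/translate_sim.
Qed.

(** The vertices of [c] and [c'] differ by a function into the group, which is an
    Eilenberg-Mac Lane cube by [EM_cell_diff]. *)
Lemma EM_act_trans m (c c' : Y m) :
  e m c' = e m c -> exists g : EM n.+1 A m, alpha m (g, c) = c'.
Proof.
move=> /esym /(proj2 he) cc'.
have [f fE] := choice (fun v : cube m => translate_trans edges H (cc' v)).
have fc' : opc (@translate _ _ _ _ _ edges _ H) [ffun v => f v] (vtx c) = vtx c'.
  by apply: funext => v; rewrite /opc ffunE -{2}(funfin v) fE funfin.
have gEM : EM_cell n.+1 [ffun v => f v].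
  apply: (@EM_cell_diff _ (cubesC hY fY) n A (@translate _ _ _ _ _ edges _ H)
    (@translate0 _ _ _ _ _ edges _ H) (@translateD _ _ _ _ _ edges _ H)
    (@translate_free _ _ _ _ _ edges _ H) (@translate_shift _ _ _ _ _ edges _ H)
    (@nstep_rigid Y hY fY _ sY) m _ (vtx c)).
    exact: cubes_vtx.
  by rewrite fc'; apply: cubes_vtx.
exists (exist _ _ gEM); apply: vtx_inj => // v.
by rewrite vtx_EM_act -fc'.
Qed.

Lemma EM_act_bundle : principal_bundle e alpha.
Proof.
split.
- split=> [m c|m a b c]; apply: vtx_inj => // v; rewrite !vtx_EM_act.
    by rewrite ffunE translate0.
  by rewrite /= ffunE translateD.
- exists EM_act_over; apply: iso_bij => m.
    move=> [[g hg] c] [[g' hg'] c'] /(congr1 (fun z => sval z)) /= [gc cc'].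
    rewrite -{}cc' in gc *; congr pair; apply: eq_exist; apply/ffunP => v.
    have := congr1 (fun d => vtx d v) gc; rewrite !vtx_EM_act /= finfunK.
    exact: translate_free.
  move=> [[c' c] /= cc']; have [g gc] := EM_act_trans cc'.
  by exists (g, c); apply: eq_exist; congr pair; exact: gc.
apply: csurj_coequalizer; [exact: (proj1 he)|exact: EM_act_over|] => m c' c.
by move/EM_act_trans => [g gc]; exists (g, c).
Qed.

End Bundle.

Section Tower.
Variables (X : cubeset) (hX : concrete_ergodic_fibrant X).

Lemma tower_concrete : concrete X. Proof. by case: hX. Qed.
Lemma tower_fibrant : fibrant X. Proof. by case: hX. Qed.

Lemma tau_nquot n : nquot tower_concrete tower_fibrant n (tau_unit n X).
Proof. exact/truncation_nquot/tauP. Qed.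

Lemma tau_concrete n : concrete (tau n X).
Proof. exact: nquot_concrete (tau_nquot n). Qed.

Lemma tau_fibrant n : fibrant (tau n X).
Proof. exact: nquot_fibrant (tau_nquot n). Qed.

Lemma tau_projE n : tau_proj n X \oc tau_unit n.+1 X = tau_unit n X.
Proof. exact: tau_extE. Qed.

(** A map from [tau n.+1 X] to an [n]-step cubeset is determined by its composite with the
    unit, since [n]-step cubesets are also [n.+1]-step. *)
Lemma tau_proj_truncation n : is_truncation n (tau_proj n X).
Proof.
split=> [|Y sY F]; first exact: tau_step.
have gE := tau_extE sY (F \oc tau_unit n.+1 X).
exists (tau_ext sY (F \oc tau_unit n.+1 X)); split.
  apply: (tau_ext_uniq (nstepS sY)); rewrite -[RHS]gE.
  by apply: cmap_eq => m x /=; have /= -> := cmap_congr x (tau_projE n).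
move=> k kF; apply: (tau_ext_uniq sY); rewrite gE -kF.
by apply: cmap_eq => m x /=; have /= -> := cmap_congr x (tau_projE n).
Qed.

Lemma tau_proj_nquot n : nquot (@tau_concrete n.+1) (@tau_fibrant n.+1) n (tau_proj n X).
Proof. exact/truncation_nquot/tau_proj_truncation. Qed.

(** In the 0-th truncation all points are identified, and [nsim] for [n = 0] says that two
    points span an edge. *)
Lemma ergodic_edges (I : finType) (i : I) (p q : X 0) :
  cubes (fun x : I -> bool => if x i then q else p).
Proof.
have [_ [g [gK _]] _] := hX.
have e : tau_unit 0 X 0 p = tau_unit 0 X 0 q.
  by rewrite -[LHS](cmap_congr _ gK) -[RHS](cmap_congr _ gK).
have pq := proj1 (nquot_eq0 (tau_nquot 0) p q) e.
have am : adm (fun (x : I -> bool) (_ : 'I_1) => x i) by exact: adm_pull.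
apply: (is_cube_ext _ (is_cube_pre am pq)) => x /=.
congr (if _ then _ else _); apply/forallP/idP => [|xi _] //.
by apply; exact: ord0.
Qed.

Lemma tau_edges n (I : finType) (i : I) (p q : tau n X 0) :
  cubesC (@tau_concrete n) (@tau_fibrant n) I (fun x => if x i then q else p).
Proof.
have [p' <-] := proj1 (tau_nquot n) 0 p; have [q' <-] := proj1 (tau_nquot n) 0 q.
apply: is_cube_ext (cubes_map (tau_unit n X) (ergodic_edges i p' q') : cubesC _ _ _ _) => x.
by case: (x i).
Qed.

Lemma tpi_abelian (x0 : X 0) n : abelian_law (tpi_mul n X x0).
Proof. exact: pi_abelian_law (tau_step n.+1 X) (@tau_edges n.+1) _. Qed.

Definition tower_act (x0 : X 0) n :
  cmap (cprod (EM n.+1 (law_group (tpi_abelian x0 n))) (tau n.+1 X)) (tau n.+1 X) :=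
  EM_act (@tau_edges n.+1) (tpi_abelian x0 n).

End Tower.

Theorem mainTheorem2 :
  exists (pi_abelian : forall X : cubeset, concrete_ergodic_fibrant X ->
            forall (x0 : X 0) (n : nat), abelian_law (tpi_mul n X x0))
         (alpha : forall (X : cubeset) (hX : concrete_ergodic_fibrant X)
            (x0 : X 0) (n : nat),
            cmap (cprod (EM n.+1 (law_group (pi_abelian X hX x0 n))) (tau n.+1 X))
                 (tau n.+1 X)),
    (forall (X : cubeset) (hX : concrete_ergodic_fibrant X),
       [/\ forall n, csurj (tau_unit n X) /\ fibration (tau_unit n X),
           forall n, csurj (tau_proj n X) /\ fibration (tau_proj n X),
           forall n, tau_proj n X \oc tau_unit n.+1 X = tau_unit n X,
           forall n, [/\ concrete (tau n X), fibrant (tau n X) & nstep n (tau n X)] &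
           forall (x0 : X 0) n, principal_bundle (tau_proj n X) (alpha X hX x0 n)]) /\
    (forall (X Y : cubeset) (hX : concrete_ergodic_fibrant X)
       (hY : concrete_ergodic_fibrant Y) (f : cmap X Y),
       [/\ forall n, tau_map n f \oc tau_unit n X = tau_unit n Y \oc f,
           forall n, tau_map n f \oc tau_proj n X = tau_proj n Y \oc tau_map n.+1 f &
           forall (x0 : X 0) n k
                  (a : EM n.+1 (law_group (pi_abelian X hX x0 n)) k)
                  (p : tau n.+1 X k),
             tau_map n.+1 f k (alpha X hX x0 n k (a, p)) =
             alpha Y hY (f 0 x0) n k
               (@EM_map n.+1 (law_group (pi_abelian X hX x0 n))
                  (law_group (pi_abelian Y hY (f 0 x0) n))
                  (tpi_map n.+1 X Y f x0) (tpi_map_mul n X Y f x0) k a,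
                tau_map n.+1 f k p)]).
Proof.
exists tpi_abelian, tower_act; split=> [X hX|X Y hX hY f].
  split=> [n|n|n|n|x0 n].
  - by split; [case: (tau_nquot hX n)|exact: nquot_fibration (tau_nquot hX n)].
  - by split; [case: (tau_proj_nquot hX n)|exact: nquot_fibration (tau_proj_nquot hX n)].
  - exact: tau_projE.
  - by split; [exact: tau_concrete|exact: tau_fibrant|exact: tau_step].
  - exact: EM_act_bundle (tau_proj_nquot hX n).
split=> [n|n|x0 n k a p].
- exact: tau_map_unit.
- apply: (tau_ext_uniq (nstepS (tau_step n Y))); apply: cmap_eq => m x /=.
  have /= -> := cmap_congr x (tau_projE X n).
  have /= -> := cmap_congr x (tau_map_unit n f).
  have /= -> := cmap_congr x (tau_map_unit n.+1 f).
  by have /= -> := cmap_congr (f m x) (tau_projE Y n).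
apply: (vtx_inj (@tau_concrete Y hY n.+1)) => v.
rewrite -vtx_map !vtx_EM_act /= ffunE -vtx_map.
exact: translate_nat (tau_map_unit0 n.+1 f x0) _ _ _ _.
Qed.
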